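(* For every $1\leq r\leq\infty$ and $k\geq8$ there exist $\mathscr{F}\in\mathrm{RT}^r_{k+1}(\mathbb{S}^1)$ and $\mathscr{G}\in\mathrm{RT}^r_k(\mathbb{S}^1)$ such that $\mathscr{F}$ is minimal but $\mathscr{F}^{-1}$ is not minimal, and neither $\mathscr{G}$ nor $\mathscr{G}^{-1}$ is minimal.
   Context: $\mathrm{IFS}^r_k(\mathbb{S}^1)$ is the set of families of $k$ orientation-preserving $C^r$ circle diffeomorphisms, identified up to reordering, with metric $\bar{\mathrm{d}}_r(\mathscr{F},\mathscr{G})=\min_{\sigma\in S_k}\sum_i\mathrm{d}_r(f_i,g_{\sigma(i)})$. A family is minimal if the orbit $\{h(x):h\in\langle\mathscr{F}\rangle^+\}$ of every point is dense ($\langle\mathscr{F}\rangle^+$ = semigroup of finite compositions), transitive if the orbit $\bigcup_{h\in\langle\mathscr{F}\rangle^+}h(U)$ of every nonempty open set $U$ is dense. $\mathrm{RT}^r_k(\mathbb{S}^1)$ is the set of $\mathscr{F}\in\mathrm{IFS}^r_k(\mathbb{S}^1)$ having a $\bar{\mathrm{d}}_r$-neighborhood consisting of transitive families. $\mathscr{F}^{-1}=\{f^{-1}:f\in\mathscr{F}\}$. *)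

(* Defs.v *)
(* Circle S^1 = R/Z; circle maps are represented by lifts R -> R. *)
From Stdlib Require Import Reals Lra List Permutation.
From Coquelicot Require Import Coquelicot.
Open Scope R_scope.

Inductive reg : Type := Fin : nat -> reg | Inf : reg.

Definition le_reg (n : nat) (r : reg) : Prop :=
  match r with Fin m => (n <= m)%nat | Inf => True end.

Definition Cr (r : reg) (F : R -> R) : Prop :=
  forall n : nat, le_reg n r -> forall x : R,
    ex_derive_n F n x /\ continuous (Derive_n F n) x.

(* F is a lift of an orientation-preserving C^r diffeomorphism of S^1 = R/Z *)
Definition lift_diff (r : reg) (F : R -> R) : Prop :=
  Cr r F /\ (forall x, F (x + 1) = F x + 1) /\ (forall x, 0 < Derive F x).

(* IFS^r_k(S^1): families of k such maps (a list; the order is irrelevant, see dbar_lt) *)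
Definition IFS (r : reg) (k : nat) (Fs : list (R -> R)) : Prop :=
  length Fs = k /\ List.Forall (lift_diff r) Fs.

Definition dist_circ (a b : R) : R :=
  Rmin (frac_part (a - b)) (1 - frac_part (a - b)).

Definition sup_R (E : R -> Prop) : R := real (Lub_Rbar E).

Definition dj (F G : R -> R) (j : nat) : R :=
  match j with
  | O => sup_R (fun y => exists x, y = dist_circ (F x) (G x))
  | S _ => sup_R (fun y => exists x, y = Rabs (Derive_n F j x - Derive_n G j x))
  end.

Definition dr (r : reg) (F G : R -> R) : R :=
  match r with
  | Fin m => sum_f_R0 (dj F G) m
  | Inf => Series (fun j => (/ 2) ^ j * Rmin 1 (dj F G j))
  end.

Definition fam_dist (r : reg) (Fs Gs : list (R -> R)) : R :=
  fold_right Rplus 0 (map (fun p => dr r (fst p) (snd p)) (combine Fs Gs)).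

(* dbar_r(Fs, Gs) < eps, where dbar_r = min over reorderings of the sum of d_r *)
Definition dbar_lt (r : reg) (Fs Gs : list (R -> R)) (eps : R) : Prop :=
  exists Gs', Permutation Gs Gs' /\ fam_dist r Fs Gs' < eps.

(* open subsets of S^1, as Z-periodic open subsets of R *)
Definition circ_open (U : R -> Prop) : Prop :=
  (forall x, U x <-> U (x + 1)) /\
  (forall x, U x -> exists e, 0 < e /\ forall y, Rabs (y - x) < e -> U y).

Inductive in_sg (Fs : list (R -> R)) : (R -> R) -> Prop :=
| sg_gen : forall f, In f Fs -> in_sg Fs f
| sg_comp : forall f h, In f Fs -> in_sg Fs h -> in_sg Fs (fun x => f (h x)).

Definition minimal (Fs : list (R -> R)) : Prop :=
  forall x V, circ_open V -> (exists y, V y) ->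
    exists h, in_sg Fs h /\ V (h x).

Definition transitive (Fs : list (R -> R)) : Prop :=
  forall U V, circ_open U -> (exists y, U y) -> circ_open V -> (exists y, V y) ->
    exists h x, in_sg Fs h /\ U x /\ V (h x).

Definition RT (r : reg) (k : nat) (Fs : list (R -> R)) : Prop :=
  IFS r k Fs /\
  exists eps, 0 < eps /\
    forall Gs, IFS r k Gs -> dbar_lt r Fs Gs eps -> transitive Gs.

Definition inverse_family (Fs Gs : list (R -> R)) : Prop :=
  List.Forall2 (fun f g => forall x, f (g x) = x /\ g (f x) = x) Fs Gs.

(* Main.v *)
(* A blender (two contractions of an arc I' whose images of a smaller arc I cover I) makes the
   orbit of every point of I' accumulate on all of I, robustly. Robust transitivity follows
   when open sets can be sent into I' and pulled back into I; for this it is enough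
   that each point either does so by itself under some word or lies in an interval which some
   word expands and whose endpoints do so: an interval of bad points would be
   expanded forever. These conditions survive C^1-perturbations by compactness.

   A common fixed point, with one map expanding and one contracting there, makes neither the
   family nor its inverse minimal. For a minimal family with non-minimal inverse, let K be the
   Cantor set of those x with 3^(n+1) x mod 1 in [0,1/2] for all n, which is invariant under
   x + 1/3. One map f is built with f^-1(K) contained in K, contracting [0,1/2] by 1/3 but
   sending part of K into the gaps; together with the rotation it sends every point
   into a gap, where a blender acts by maps fixing the other points. *)
Require Import Defs.
From Stdlib Require Import Reals Lra Lia List Permutation ZArith FunctionalExtensionality Classical ClassicalEpsilon.
From Coquelicot Require Import Coquelicot.
Open Scope R_scope.

(** * Lifts of class C^1 and their semigroups *)

(** The delicate point is the map f of the minimal family: K must satisfy f(K) ⊇ K, yet minimality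
    forces some points of K to leak into gaps. K is self-similar with ratio 1/3, so the natural
    local models are similarities by powers of 3. Once [0,1/2] is contracted onto [0,1/6], the rest
    of K, which lies in [1/3,5/6], has to come from the piece of K in [2/3,5/6]. Stretching that
    whole piece by 3 would give f(K) = K and no leak. Instead only its first third [2/3,13/18],
    which again carries a copy of K, is stretched by 9 onto [1/3,5/6]. The interval (13/18,1) is
    then free to go into the gap (5/6,1), and the points of K in (13/18,5/6] go with it. The
    contraction of [0,1/2] serves a second purpose: its inverse is the expansion required by the
    backward condition, and the rotation by thirds carries it to the other pieces of K. *)

Definition C1lift (f : R -> R) : Prop :=
  (forall x, ex_derive f x) /\ (forall x, continuous (Derive f) x) /\
  (forall x, f (x + 1) = f x + 1) /\ (forall x, 0 < Derive f x).

(** All dynamical arguments use one derivative; [r] enters only through the metric and through the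
    regularity of the constructed maps. *)
Lemma lift_diff_C1lift r f : le_reg 1 r -> lift_diff r f -> C1lift f.
Proof.
  intros Hr (HC & Hp & Hd).
  split; [|split; [|split; [exact Hp|exact Hd]]]; intros x;
    apply (HC 1%nat Hr x).
Qed.

Lemma translate_Z (f : R -> R) :
  (forall x, f (x + 1) = f x + 1) -> forall (k : Z) x, f (x + IZR k) = f x + IZR k.
Proof.
  intros Hp.
  assert (Hn : forall (n : nat) x, f (x + INR n) = f x + INR n).
  { induction n as [|n IH]; intros x.
    - simpl; rewrite !Rplus_0_r; reflexivity.
    - rewrite S_INR, <- Rplus_assoc, Hp, IH; ring. }
  intros k x. destruct (Z_le_gt_dec 0 k) as [Hk|Hk].
  - rewrite <- (Z2Nat.id k Hk), <- INR_IZR_INZ. apply Hn.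
  - assert (E : IZR k = - INR (Z.to_nat (- k))).
    { rewrite INR_IZR_INZ, Z2Nat.id by lia. rewrite <- opp_IZR. f_equal; lia. }
    rewrite E. generalize (Hn (Z.to_nat (- k)) (x + - INR (Z.to_nat (- k)))).
    replace (x + - INR (Z.to_nat (- k)) + INR (Z.to_nat (- k))) with x by ring. lra.
Qed.

Lemma periodic_Z (V : R -> Prop) :
  (forall x, V x <-> V (x + 1)) -> forall (k : Z) x, V (x + IZR k) <-> V x.
Proof.
  intros Hp.
  assert (Hn : forall (n : nat) x, V (x + INR n) <-> V x).
  { induction n as [|n IH]; intros x.
    - simpl; rewrite Rplus_0_r; tauto.
    - rewrite S_INR, <- Rplus_assoc, <- Hp; apply IH. }
  intros k x. destruct (Z_le_gt_dec 0 k) as [Hk|Hk].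
  - rewrite <- (Z2Nat.id k Hk), <- INR_IZR_INZ. apply Hn.
  - assert (E : IZR k = - INR (Z.to_nat (- k))).
    { rewrite INR_IZR_INZ, Z2Nat.id by lia. rewrite <- opp_IZR. f_equal; lia. }
    rewrite E. generalize (Hn (Z.to_nat (- k)) (x + - INR (Z.to_nat (- k)))).
    replace (x + - INR (Z.to_nat (- k)) + INR (Z.to_nat (- k))) with x by ring. tauto.
Qed.

Lemma exists_floor x : exists k : Z, 0 <= x - IZR k < 1.
Proof.
  exists (up x - 1)%Z. destruct (archimed x). rewrite minus_IZR. lra.
Qed.

Lemma C1lift_Z f : C1lift f -> forall (k : Z) x, f (x + IZR k) = f x + IZR k.
Proof. intros (_ & _ & Hp & _). apply translate_Z, Hp. Qed.

Lemma C1lift_Derive_Z f : C1lift f -> forall (k : Z) x, Derive f (x + IZR k) = Derive f x.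
Proof.
  intros Hf k x.
  assert (E : Derive (fun y => f (y + IZR k)) x = Derive f (x + IZR k)).
  { apply is_derive_unique.
    replace (Derive f (x + IZR k)) with (scal 1 (Derive f (x + IZR k))) by apply Rmult_1_l.
    apply (is_derive_comp f (fun y => y + IZR k)).
    - apply Derive_correct, Hf.
    - auto_derive; auto. }
  rewrite <- E.
  rewrite (Derive_ext _ (fun y => f y + IZR k)) by (intros; apply C1lift_Z, Hf).
  rewrite Derive_plus by (try apply Hf; apply ex_derive_const).
  rewrite Derive_const; ring.
Qed.

Lemma C1lift_MVT f : C1lift f ->
  forall x y, x <= y -> exists c, x <= c <= y /\ f y - f x = Derive f c * (y - x).
Proof.
  intros Hf x y Hxy.
  destruct (MVT_gen f x y (Derive f)) as (c & Hc & E).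
  - intros; apply Derive_correct, Hf.
  - intros. apply continuity_pt_filterlim.
    apply (ex_derive_continuous f), Hf.
  - rewrite Rmin_left, Rmax_right in Hc by auto. exists c; auto.
Qed.

Lemma C1lift_lt f : C1lift f -> forall x y, x < y -> f x < f y.
Proof.
  intros Hf x y Hxy. destruct (C1lift_MVT f Hf x y) as (c & Hc & E); [lra|].
  assert (0 < Derive f c) by apply Hf. nra.
Qed.

Lemma C1lift_le f : C1lift f -> forall x y, x <= y -> f x <= f y.
Proof.
  intros Hf x y [H|H]; [left; apply C1lift_lt; auto|right; subst; auto].
Qed.

Lemma C1lift_continuity f : C1lift f -> continuity f.
Proof.
  intros Hf x. apply continuity_pt_filterlim, (ex_derive_continuous f), Hf.
Qed.

Lemma C1lift_cont f : C1lift f -> forall x e, 0 < e ->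
  exists d, 0 < d /\ forall y, Rabs (y - x) < d -> Rabs (f y - f x) < e.
Proof.
  intros Hf x e He.
  destruct (C1lift_continuity f Hf x e He) as (d & Hd & H).
  exists d; split; [exact Hd|]. intros y Hy.
  destruct (Req_dec x y) as [->|N].
  - rewrite Rminus_diag, Rabs_R0; auto.
  - apply (H y). split; [split; [exact I|exact N]|exact Hy].
Qed.

Lemma C1lift_IVT f : C1lift f -> forall a b y, a <= b -> f a <= y <= f b ->
  exists x, a <= x <= b /\ f x = y.
Proof.
  intros Hf a b y Hab Hy.
  destruct (IVT_gen f a b y (C1lift_continuity f Hf)) as (x & Hx & E).
  - rewrite Rmin_left, Rmax_right; lra.
  - rewrite Rmin_left, Rmax_right in Hx by auto. exists x; auto.
Qed.

Lemma C1lift_IVT_lt f : C1lift f -> forall a b y, a < b -> f a < y < f b ->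
  exists x, a < x < b /\ f x = y.
Proof.
  intros Hf a b y Hab Hy.
  destruct (C1lift_IVT f Hf a b y) as (x & Hx & E); [lra|lra|].
  exists x; split; [|exact E].
  split; apply Rnot_le_lt; intros H; apply (C1lift_le f Hf) in H; lra.
Qed.

Lemma C1lift_inverse f : C1lift f -> exists g, forall x, f (g x) = x /\ g (f x) = x.
Proof.
  intros Hf.
  assert (S : forall y, exists x, f x = y).
  { intros y. destruct (exists_floor (y - f 0)) as (k & Hk).
    generalize (C1lift_Z f Hf k 0) (C1lift_Z f Hf (k + 1) 0). rewrite plus_IZR.
    intros E1 E2.
    destruct (C1lift_IVT f Hf (0 + IZR k) (0 + (IZR k + 1)) y) as (x & _ & E); [lra|lra|].
    exists x; exact E. }
  exists (fun y => proj1_sig (constructive_indefinite_description _ (S y))).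
  intros x; split; destruct constructive_indefinite_description as (z & Hz); simpl; auto.
  destruct (Rtotal_order z x) as [H|[H|H]]; auto; apply (C1lift_lt f Hf) in H; lra.
Qed.

Lemma C1lift_Derive_bound f : C1lift f -> exists M, 0 < M /\ forall x, Derive f x <= M.
Proof.
  intros Hf.
  destruct (continuity_ab_maj (Derive f) 0 1) as (c & Hc & _); [lra| |].
  - intros; apply continuity_pt_filterlim, Hf.
  - exists (Derive f c); split; [apply Hf|]. intros x.
    destruct (exists_floor x) as (k & Hk).
    replace x with (x - IZR k + IZR k) by ring. rewrite C1lift_Derive_Z by auto.
    apply Hc; lra.
Qed.

Lemma C1lift_Derive_unif f : C1lift f -> forall e, 0 < e ->
  exists d, 0 < d /\ forall x y, Rabs (x - y) < d -> Rabs (Derive f x - Derive f y) < e.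
Proof.
  intros Hf e He.
  assert (C : forall x, -1 <= x <= 2 -> continuity_pt (Derive f) x).
  { intros; apply continuity_pt_filterlim, Hf. }
  destruct (Heine_cor2 C (mkposreal e He)) as ((d & Hd) & H).
  simpl in H. exists (Rmin d 1); split; [apply Rmin_pos; lra|].
  intros x y Hxy. destruct (exists_floor x) as (k & Hk).
  assert (Rabs (x - y) < d) by (eapply Rlt_le_trans; [exact Hxy|apply Rmin_l]).
  assert (H1 : Rabs (x - y) < 1) by (eapply Rlt_le_trans; [exact Hxy|apply Rmin_r]).
  replace x with (x - IZR k + IZR k) by ring.
  replace y with (y - IZR k + IZR k) by ring.
  rewrite !C1lift_Derive_Z by auto.
  apply Rabs_def2 in H1. apply H; try lra.
  replace (x - IZR k - (y - IZR k)) with (x - y) by ring. auto.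
Qed.

Lemma Derive_comp_C1lift f h x : C1lift f -> C1lift h ->
  Derive (fun x => f (h x)) x = Derive h x * Derive f (h x).
Proof. intros Hf Hh. apply (Derive_comp f h); [apply Hf|apply Hh]. Qed.

Lemma C1lift_comp f h : C1lift f -> C1lift h -> C1lift (fun x => f (h x)).
Proof.
  intros Hf Hh.
  split; [|split; [|split]]; intros x.
  - apply (ex_derive_comp f h); [apply Hf|apply Hh].
  - apply continuous_ext with (f := fun x => Derive h x * Derive f (h x)).
    { intros; symmetry; apply Derive_comp_C1lift; auto. }
    apply (continuous_mult (Derive h) (fun x => Derive f (h x))); [apply Hh|].
    apply continuous_comp; [|apply Hf]. apply (ex_derive_continuous h), Hh.
  - destruct Hh as (_ & _ & Eh & _). rewrite Eh. apply Hf.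
  - rewrite Derive_comp_C1lift by auto. apply Rmult_lt_0_compat; [apply Hh|apply Hf].
Qed.

Lemma in_sg_comp Fs f h : in_sg Fs f -> in_sg Fs h -> in_sg Fs (fun x => f (h x)).
Proof.
  intros Hf Hh. induction Hf as [f Hf|f f' Hf Hf' IH].
  - apply sg_comp; auto.
  - apply (sg_comp Fs f (fun x => f' (h x))); auto.
Qed.

Lemma in_sg_C1lift Fs h : List.Forall C1lift Fs -> in_sg Fs h -> C1lift h.
Proof.
  intros HF Hh. rewrite Forall_forall in HF.
  induction Hh as [f Hf|f h Hf Hh IH]; [auto|apply C1lift_comp; auto].
Qed.

(** Iterates are counted from one because the semigroup consists of nonempty words. *)
Lemma in_sg_iter Fs f n : In f Fs -> in_sg Fs (fun x => Nat.iter (S n) f x).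
Proof.
  intros Hf. induction n as [|n IH].
  - apply (sg_gen Fs f Hf).
  - apply (sg_comp Fs f _ Hf IH).
Qed.

(** The metric sees values modulo 1, so lifts of nearby circle maps may differ by an integer, the
    same one at all points. *)
Definition close (d : R) (f g : R -> R) : Prop :=
  exists k : Z, forall x,
    Rabs (g x - f x - IZR k) < d /\ Rabs (Derive g x - Derive f x) < d.

(** One-sided, since further members of [Gs] only enlarge orbits. It also forgets the permutation
    hidden in the metric. *)
Definition fam_close (d : R) (Fs Gs : list (R -> R)) : Prop :=
  forall f, In f Fs -> exists g, In g Gs /\ close d f g.

Lemma close_le d d' f g : d <= d' -> close d f g -> close d' f g.
Proof.
  intros Hd (k & H). exists k; intros x; destruct (H x); lra.
Qed.

Lemma fam_close_le d d' Fs Gs : d <= d' -> fam_close d Fs Gs -> fam_close d' Fs Gs.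
Proof.
  intros Hd H f Hf. destruct (H f Hf) as (g & Hg & Hc).
  exists g; split; auto. eapply close_le; eauto.
Qed.

Lemma fam_close_refl d Fs : 0 < d -> fam_close d Fs Fs.
Proof.
  intros Hd f Hf. exists f; split; auto. exists 0%Z; intros x.
  replace (f x - f x - 0) with 0 by ring. rewrite Rminus_diag, Rabs_R0; lra.
Qed.

Lemma close_comp f h : C1lift f -> C1lift h -> forall e, 0 < e ->
  exists d, 0 < d /\ forall f' h', C1lift f' -> C1lift h' ->
    close d f f' -> close d h h' -> close e (fun x => f (h x)) (fun x => f' (h' x)).
Proof.
  intros Hf Hh e He.
  destruct (C1lift_Derive_bound f Hf) as (M & HM & HfM).
  destruct (C1lift_Derive_bound h Hh) as (N & HN & HhN).
  (* The divisor pays for both errors: at most M + 1 times [e1] in the value, and at most M + 2 (N +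
     1) times [e1] in the derivative. *)
  set (e1 := e / (2 * (M + N + 1))).
  assert (He1 : 0 < e1) by (unfold e1; apply Rdiv_lt_0_compat; lra).
  assert (Ee1 : e1 * (2 * (M + N + 1)) = e) by (unfold e1; field; lra).
  destruct (C1lift_Derive_unif f Hf e1 He1) as (d1 & Hd1 & Hu).
  exists (Rmin d1 (Rmin e1 1)).
  assert (Hm1 := Rmin_l d1 (Rmin e1 1)). assert (Hm2 := Rmin_r d1 (Rmin e1 1)).
  assert (Hm3 := Rmin_l e1 1). assert (Hm4 := Rmin_r e1 1).
  set (d := Rmin d1 (Rmin e1 1)) in *.
  split. { unfold d; repeat apply Rmin_pos; lra. }
  intros f' h' Hf' Hh' (kf & Cf) (kh & Ch).
  exists (kf + kh)%Z. intros x.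
  destruct (Ch x) as (Ch0 & Ch1). destruct (Cf (h' x)) as (Cf0 & Cf1).
  set (y := h' x - IZR kh).
  assert (Ey : h' x = y + IZR kh) by (unfold y; ring).
  assert (Hy : Rabs (y - h x) < d).
  { unfold y. replace (h' x - IZR kh - h x) with (h' x - h x - IZR kh) by ring; auto. }
  split.
  - assert (E : f (h' x) = f y + IZR kh) by (rewrite Ey; apply C1lift_Z, Hf).
    assert (B : Rabs (f y - f (h x)) <= M * d).
    { apply Rabs_def2 in Hy. apply Rabs_le.
      destruct (Rle_dec y (h x)) as [L|L].
      - destruct (C1lift_MVT f Hf y (h x) L) as (c & _ & E').
        assert (0 < Derive f c) by apply Hf. specialize (HfM c). nra.
      - destruct (C1lift_MVT f Hf (h x) y) as (c & _ & E'); [lra|].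
        assert (0 < Derive f c) by apply Hf. specialize (HfM c). nra. }
    rewrite plus_IZR.
    apply Rabs_def2 in Cf0. apply Rabs_le_between in B. apply Rabs_def1; nra.
  - rewrite (Derive_comp_C1lift f h), (Derive_comp_C1lift f' h') by auto.
    assert (B : Rabs (Derive f (h' x) - Derive f (h x)) < e1).
    { rewrite Ey, C1lift_Derive_Z by auto. apply Hu; lra. }
    assert (P1 : 0 < Derive f (h x)) by apply Hf.
    assert (P2 : 0 < Derive h x) by apply Hh.
    specialize (HfM (h x)). specialize (HhN x).
    assert (P3 : 0 < Derive h' x) by apply Hh'.
    set (a := Derive h' x) in *. set (b := Derive f' (h' x)) in *.
    set (c := Derive h x) in *. set (m := Derive f (h' x)) in *.
    set (n := Derive f (h x)) in *.
    apply Rabs_def2 in B. apply Rabs_def2 in Cf1. apply Rabs_def2 in Ch1.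
    assert (X : Rabs (b - n) <= 2 * e1) by (apply Rabs_le; lra).
    assert (Y : Rabs (a - c) <= e1) by (apply Rabs_le; lra).
    assert (Y1 : Rabs (a - c) <= 1) by (apply Rabs_le; lra).
    replace (a * b - c * n) with ((a - c) * n + a * (b - n)) by ring.
    eapply Rle_lt_trans; [apply Rabs_triang|]. rewrite !Rabs_mult.
    rewrite (Rabs_pos_eq n), (Rabs_pos_eq a) by lra.
    assert (a <= N + 1) by (apply Rabs_le_between in Y1; lra).
    assert (Rabs (a - c) * n <= e1 * M).
    { apply Rmult_le_compat; try lra; apply Rabs_pos. }
    assert (a * Rabs (b - n) <= (N + 1) * (2 * e1)).
    { apply Rmult_le_compat; try lra; apply Rabs_pos. }
    nra.
Qed.

(** Closeness degrades along a word, so [d] depends on [h]; compactness will leave only finitely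
    many words to control. *)
Lemma sg_close Fs h : List.Forall C1lift Fs -> in_sg Fs h -> forall e, 0 < e ->
  exists d, 0 < d /\ forall Gs, List.Forall C1lift Gs -> fam_close d Fs Gs ->
    exists h', in_sg Gs h' /\ close e h h'.
Proof.
  intros HF Hh. induction Hh as [f Hf|f h Hf Hh IH]; intros e He.
  - exists e; split; auto. intros Gs _ HG. destruct (HG f Hf) as (g & Hg & Hc).
    exists g; split; auto. apply sg_gen; auto.
  - assert (Lf : C1lift f) by (rewrite Forall_forall in HF; auto).
    destruct (close_comp f h Lf (in_sg_C1lift _ _ HF Hh) e He) as (d1 & Hd1 & H1).
    destruct (IH d1 Hd1) as (d2 & Hd2 & H2).
    exists (Rmin d1 d2); split; [apply Rmin_pos; auto|].
    intros Gs LG HG.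
    destruct (H2 Gs LG) as (h' & Hh' & Ch').
    { eapply fam_close_le; [apply Rmin_r|exact HG]. }
    destruct (HG f Hf) as (g & Hg & Cg).
    exists (fun x => g (h' x)); split; [apply sg_comp; auto|].
    apply H1; auto.
    + rewrite Forall_forall in LG; auto.
    + eapply in_sg_C1lift; eauto.
    + eapply close_le; [apply Rmin_l|exact Cg].
Qed.

(** * Blenders and robust transitivity *)

Ltac Rmin_bounds :=
  repeat match goal with
  | |- context [Rmin ?a ?b] =>
    lazymatch a with context [Rmin _ _] => fail | _ =>
    lazymatch b with context [Rmin _ _] => fail | _ =>
      let m := fresh "m" in
      generalize (Rmin_l a b) (Rmin_r a b); set (m := Rmin a b); clearbody m; intros
    end end
  end.

(** A bad interval starting in (p, q) cannot reach [q], which is good. Hence [phi] stretches all of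
    it, and the image is bad again. After enough rounds the interval is longer than 1 and must
    contain a good point. [phi] is abstract because it is a word in the forward case and an inverse
    branch of a word in the backward case. *)
Lemma expanding_reach (good : R -> Prop) lam : 1 < lam ->
  (forall a, exists z, a <= z <= a + 1 /\ good z) ->
  (forall y, good y \/ exists p q (phi : R -> R),
     p < y < q /\ good p /\ good q /\
     (forall s t, p <= s -> s <= t -> t <= q -> lam * (t - s) <= phi t - phi s) /\
     (forall s t w, p <= s -> s <= t -> t <= q -> phi s <= w <= phi t ->
        exists z, s <= z <= t /\ phi z = w) /\
     (forall z, p <= z <= q -> good (phi z) -> good z)) ->
  forall s t, s < t -> exists z, s <= z <= t /\ good z.
Proof.
  intros Hl H1 H s t Hst.
  apply NNPP; intros Hbad.
  assert (G : forall n : nat, exists a b,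
    lam ^ n * (t - s) <= b - a /\ forall z, a <= z <= b -> ~ good z).
  { induction n as [|n (a & b & Hab & Hn)].
    - exists s, t; split; [simpl; lra|]. intros z Hz Gz. apply Hbad; eauto.
    - assert (Pn : 0 < lam ^ n) by (apply pow_lt; lra).
      assert (a < b) by nra.
      destruct (H a) as [Ga|(p & q & phi & Hpq & Gp & Gq & E & S & I)].
      { exfalso; apply (Hn a); [lra|auto]. }
      assert (b < q).
      { apply Rnot_le_lt; intros L. apply (Hn q); [lra|auto]. }
      exists (phi a), (phi b); split.
      + specialize (E a b). simpl. nra.
      + intros w Hw Gw. destruct (S a b w) as (z & Hz & Ez); try lra.
        apply (Hn z Hz). apply I; [lra|]. rewrite Ez; auto. }
  destruct (Pow_x_infinity lam) with (b := 2 / (t - s)) as (N & HN).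
  { rewrite Rabs_pos_eq; lra. }
  destruct (G N) as (a & b & Hab & Hn).
  specialize (HN N (le_n N)).
  assert (0 < lam ^ N) by (apply pow_lt; lra).
  rewrite Rabs_pos_eq in HN by lra.
  assert (2 <= lam ^ N * (t - s)).
  { apply Rge_le in HN. apply (Rmult_le_compat_r (t - s)) in HN; [|lra].
    replace (2 / (t - s) * (t - s)) with 2 in HN by (field; lra). lra. }
  destruct (H1 a) as (z & Hz & Gz). apply (Hn z); [lra|auto].
Qed.

(** Compactness of [a, b] as real induction: the supremum of the points up to which [P a] holds
    cannot stop before [b]. *)
Lemma compact_induction (P : R -> R -> Prop) :
  (forall x, exists d, 0 < d /\ forall a b, x - d < a -> a <= b -> b < x + d -> P a b) ->
  (forall a b c, a <= b -> b <= c -> P a b -> P b c -> P a c) ->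
  forall a b, a <= b -> P a b.
Proof.
  intros L T a b Hab.
  set (E := fun x => a <= x <= b /\ forall y, a <= y <= x -> P a y).
  destruct (completeness E) as (m & Hub & Hlub).
  { exists b. intros x (Hx & _); lra. }
  { exists a. split; [lra|]. intros y Hy. replace y with a by lra.
    destruct (L a) as (d & Hd & H). apply H; lra. }
  assert (Ha : E a).
  { split; [lra|]. intros y Hy. replace y with a by lra.
    destruct (L a) as (d & Hd & H). apply H; lra. }
  assert (a <= m) by (apply Hub; auto).
  assert (m <= b) by (apply Hlub; intros x (Hx & _); lra).
  destruct (L m) as (d & Hd & H2).
  assert (exists x, E x /\ m - d < x) as (x & Ex & Hx).
  { apply NNPP; intros N. assert (m <= m - d); [|lra].
    apply Hlub. intros x Ex. apply Rnot_lt_le. intros Hx. apply N; eauto. }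
  assert (x <= m) by (apply Hub; auto).
  destruct Ex as (Hxab & Ex).
  assert (Q : forall y, a <= y < m + d -> P a y).
  { intros y Hy. destruct (Rle_dec y x) as [Hyx|Hyx]; [apply Ex; lra|].
    apply (T a x y); try lra; [apply Ex; lra|apply H2; lra]. }
  apply Q. split; [lra|]. apply Rnot_le_lt. intros Hb.
  assert (m + d / 2 <= m); [|lra].
  apply Hub. split; [lra|]. intros y Hy; apply Q; lra.
Qed.

(** * Forward and backward reach of a target interval *)

Definition fgood (Gs : list (R -> R)) (j0 j1 x : R) : Prop :=
  exists h (k : Z), in_sg Gs h /\ j0 < h x - IZR k < j1.

Definition fexp (Gs : list (R -> R)) (j0 j1 lam x : R) : Prop :=
  exists p q h, p < x < q /\ fgood Gs j0 j1 p /\ fgood Gs j0 j1 q /\ in_sg Gs h /\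
    forall z, p <= z <= q -> lam <= Derive h z.

Definition bgood (Gs : list (R -> R)) (i0 i1 y : R) : Prop :=
  exists h z (k : Z), in_sg Gs h /\ i0 < z < i1 /\ h z = y + IZR k.

(** Where a word contracts, its inverse branch expands, so the endpoints that have to be good are
    those of the image. Phrasing this through [h] keeps inverses out of the perturbation
    arguments. *)
Definition bexp (Gs : list (R -> R)) (i0 i1 lam y : R) : Prop :=
  exists h p q (k : Z), in_sg Gs h /\ p < q /\ h p < y + IZR k < h q /\
    bgood Gs i0 i1 (h p) /\ bgood Gs i0 i1 (h q) /\
    forall z, p <= z <= q -> lam * Derive h z <= 1.

Lemma fgood_Z Gs j0 j1 : List.Forall C1lift Gs ->
  forall (k : Z) x, fgood Gs j0 j1 x -> fgood Gs j0 j1 (x + IZR k).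
Proof.
  intros HG k x (h & k' & Hh & H). exists h, (k' + k)%Z; split; auto.
  rewrite (C1lift_Z h) by (eapply in_sg_C1lift; eauto). rewrite plus_IZR. lra.
Qed.

Lemma bgood_Z Gs i0 i1 (k : Z) y : bgood Gs i0 i1 y -> bgood Gs i0 i1 (y + IZR k).
Proof.
  intros (h & z & k' & Hh & Hz & H). exists h, z, (k' - k)%Z; split; [|split]; auto.
  rewrite minus_IZR, H. ring.
Qed.

Lemma fexp_Z Gs j0 j1 lam : List.Forall C1lift Gs ->
  forall (k : Z) x, fexp Gs j0 j1 lam x -> fexp Gs j0 j1 lam (x + IZR k).
Proof.
  intros HG k x (p & q & h & Hx & Gp & Gq & Hh & D).
  exists (p + IZR k), (q + IZR k), h. split; [lra|].
  split; [apply fgood_Z; auto|]. split; [apply fgood_Z; auto|]. split; auto.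
  intros z Hz. replace z with (z - IZR k + IZR k) by ring.
  rewrite C1lift_Derive_Z by (eapply in_sg_C1lift; eauto). apply D; lra.
Qed.

Lemma bexp_Z Gs i0 i1 lam (k : Z) y : bexp Gs i0 i1 lam y -> bexp Gs i0 i1 lam (y + IZR k).
Proof.
  intros (h & p & q & k' & Hh & Hpq & Hy & H). exists h, p, q, (k' - k)%Z.
  split; auto. split; auto. split; auto. rewrite minus_IZR. lra.
Qed.

Lemma fgood_dense Gs j0 j1 lam : List.Forall C1lift Gs -> 1 < lam ->
  (forall x, fgood Gs j0 j1 x \/ fexp Gs j0 j1 lam x) ->
  forall s t, s < t -> exists z, s <= z <= t /\ fgood Gs j0 j1 z.
Proof.
  intros HG Hl H. apply (expanding_reach _ lam Hl).
  - assert (exists x, fgood Gs j0 j1 x) as (x & Hx).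
    { destruct (H 0) as [G|(p & _ & _ & _ & G & _)]; eauto. }
    intros a. destruct (exists_floor (x - a)) as (k & Hk).
    exists (x + IZR (- k)); split; [|apply fgood_Z; auto]. rewrite opp_IZR. lra.
  - intros y. destruct (H y) as [G|(p & q & h & Hy & Gp & Gq & Hh & D)]; [left; auto|].
    right. exists p, q, h. assert (Lh : C1lift h) by (eapply in_sg_C1lift; eauto).
    split; auto. split; auto. split; auto. split; [|split].
    + intros s t Hs Hst Ht. destruct (C1lift_MVT h Lh s t Hst) as (c & Hc & E).
      rewrite E. apply Rmult_le_compat_r; [lra|]. apply D; lra.
    + intros s t w _ Hst _ Hw. apply C1lift_IVT; auto.
    + intros z _ (h' & k & Hh' & G). exists (fun x => h' (h x)), k.
      split; [apply in_sg_comp; auto|exact G].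
Qed.

Lemma bgood_dense Gs i0 i1 lam : List.Forall C1lift Gs -> 1 < lam ->
  (forall x, bgood Gs i0 i1 x \/ bexp Gs i0 i1 lam x) ->
  forall s t, s < t -> exists z, s <= z <= t /\ bgood Gs i0 i1 z.
Proof.
  intros HG Hl H. apply (expanding_reach _ lam Hl).
  - assert (exists x, bgood Gs i0 i1 x) as (x & Hx).
    { destruct (H 0) as [G|(h & p & q & k & _ & _ & _ & G & _)]; eauto. }
    intros a. destruct (exists_floor (x - a)) as (k & Hk).
    exists (x + IZR (- k)); split; [|apply bgood_Z; auto]. rewrite opp_IZR. lra.
  - intros y.
    destruct (H y) as [G|(h & p & q & k & Hh & Hpq & Hy & Gp & Gq & D)]; [left; auto|].
    right. assert (Lh : C1lift h) by (eapply in_sg_C1lift; eauto).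
    destruct (C1lift_inverse h Lh) as (g & Hg).
    assert (Mg : forall u v, u <= v -> g u <= g v).
    { intros u v Huv. apply Rnot_lt_le; intros L. apply (C1lift_lt h Lh) in L.
      rewrite !(proj1 (Hg _)) in L. lra. }
    (* The expanding map is the inverse branch of [h], shifted by [k] so as to act around [y]. *)
    exists (h p - IZR k), (h q - IZR k), (fun u => g (u + IZR k)).
    split; [lra|]. split; [|split; [|split; [|split]]].
    + unfold Rminus; rewrite <- opp_IZR; apply bgood_Z; auto.
    + unfold Rminus; rewrite <- opp_IZR; apply bgood_Z; auto.
    + intros s t Hs Hst Ht.
      assert (A : p <= g (s + IZR k)).
      { rewrite <- (proj2 (Hg p)). apply Mg; lra. }
      assert (B : g (t + IZR k) <= q).
      { rewrite <- (proj2 (Hg q)). apply Mg; lra. }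
      destruct (C1lift_MVT h Lh (g (s + IZR k)) (g (t + IZR k))) as (c & Hc & E).
      { apply Mg; lra. }
      rewrite !(proj1 (Hg _)) in E.
      assert (0 < Derive h c) by apply Lh. specialize (D c ltac:(lra)).
      assert (g (s + IZR k) <= g (t + IZR k)) by (apply Mg; lra). nra.
    + intros s t w _ Hst _ Hw. exists (h w - IZR k). split.
      * destruct Hw as (Hw1 & Hw2).
        apply (C1lift_le h Lh) in Hw1, Hw2. rewrite !(proj1 (Hg _)) in *. lra.
      * replace (h w - IZR k + IZR k) with (h w) by ring. apply Hg.
    + intros z _ (h' & x & k' & Hh' & Hx & G).
      exists (fun x => h (h' x)), x, (k + k')%Z.
      split; [apply in_sg_comp; auto|]. split; auto.
      rewrite G, C1lift_Z, (proj1 (Hg _)), plus_IZR by auto. ring.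
Qed.

(** [j0, j1] is the interval that is contracted into itself, [i0, i1] the core whose image covers
    [u, v]. Lifts are increasing, so covering is a condition on two endpoints. *)
Definition branch (eta mu j0 j1 i0 i1 u v : R) (g : R -> R) (k : Z) : Prop :=
  (forall x, j0 <= x <= j1 -> j0 + eta <= g x - IZR k <= j1 - eta /\ Derive g x <= mu - eta) /\
  g i0 - IZR k <= u - eta /\ v + eta <= g i1 - IZR k.

(* [eta] is a margin that a C^1-perturbation may use up. *)
Definition blender (eta mu j0 j1 i0 i1 : R) (Gs : list (R -> R)) : Prop :=
  j0 <= i0 /\ i1 <= j1 /\ 0 <= mu < 1 /\
  exists g1 g2 (k1 k2 : Z) c, In g1 Gs /\ In g2 Gs /\
    branch eta mu j0 j1 i0 i1 i0 c g1 k1 /\ branch eta mu j0 j1 i0 i1 c i1 g2 k2.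

Lemma branch_close eta mu j0 j1 i0 i1 u v f g k :
  branch eta mu j0 j1 i0 i1 u v f k -> close eta f g ->
  exists k', branch 0 mu j0 j1 i0 i1 u v g k'.
Proof.
  intros (B1 & B2 & B3) (m & C). exists (k + m)%Z. unfold branch. rewrite plus_IZR.
  split; [|split].
  - intros x Hx. specialize (B1 x Hx). destruct (C x) as (C1 & C2).
    apply Rabs_def2 in C1, C2. lra.
  - destruct (C i0) as (C1 & _). apply Rabs_def2 in C1. lra.
  - destruct (C i1) as (C1 & _). apply Rabs_def2 in C1. lra.
Qed.

Lemma blender_close eta mu j0 j1 i0 i1 Fs Gs :
  blender eta mu j0 j1 i0 i1 Fs -> fam_close eta Fs Gs -> blender 0 mu j0 j1 i0 i1 Gs.
Proof.
  intros (H1 & H2 & H3 & f1 & f2 & k1 & k2 & c & F1 & F2 & B1 & B2) HG.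
  destruct (HG f1 F1) as (g1 & G1 & C1). destruct (HG f2 F2) as (g2 & G2 & C2).
  destruct (branch_close _ _ _ _ _ _ _ _ _ _ _ B1 C1) as (m1 & B1').
  destruct (branch_close _ _ _ _ _ _ _ _ _ _ _ B2 C2) as (m2 & B2').
  repeat (split; auto). exists g1, g2, m1, m2, c. auto.
Qed.

(** The intermediate value theorem finds [z], the preimage of [y] in the core; the mean value
    theorem then gives the contraction around it. *)
Lemma branch_step mu j0 j1 i0 i1 u v g k : C1lift g -> j0 <= i0 -> i1 <= j1 ->
  i0 <= i1 -> branch 0 mu j0 j1 i0 i1 u v g k -> forall y, u <= y <= v ->
  exists z, i0 <= z <= i1 /\ forall x, j0 <= x <= j1 ->
    j0 <= g x - IZR k <= j1 /\ Rabs (g x - IZR k - y) <= mu * Rabs (x - z).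
Proof.
  intros Lg H0 H1 H01 (B1 & B2 & B3) y Hy.
  destruct (C1lift_IVT g Lg i0 i1 (y + IZR k)) as (z & Hz & E); [lra|lra|].
  exists z; split; auto. intros x Hx. destruct (B1 x Hx) as (Bx & _). split; [lra|].
  replace (g x - IZR k - y) with (g x - g z) by lra.
  destruct (Rle_dec z x) as [L|L].
  - destruct (C1lift_MVT g Lg z x L) as (c & Hc & Ec).
    assert (0 < Derive g c) by apply Lg. destruct (B1 c) as (_ & Bc); [lra|].
    rewrite Ec, Rabs_mult. apply Rmult_le_compat_r; [apply Rabs_pos|].
    rewrite Rabs_pos_eq; lra.
  - rewrite <- (Rabs_Ropp (x - z)), <- (Rabs_Ropp (g x - g z)).
    replace (- (g x - g z)) with (g z - g x) by ring.
    destruct (C1lift_MVT g Lg x z) as (c & Hc & Ec); [lra|].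
    assert (0 < Derive g c) by apply Lg. destruct (B1 c) as (_ & Bc); [lra|].
    rewrite Ec, Rabs_mult. replace (- (x - z)) with (z - x) by ring.
    apply Rmult_le_compat_r; [apply Rabs_pos|]. rewrite Rabs_pos_eq; lra.
Qed.

(* Backward itineraries: pull y back inside [i0,i1] n times, then contract [j0,j1] forward. *)
Lemma blender_pow mu j0 j1 i0 i1 Gs : List.Forall C1lift Gs -> blender 0 mu j0 j1 i0 i1 Gs ->
  forall (n : nat) y, i0 <= y <= i1 -> exists h (k : Z), in_sg Gs h /\
    forall x, j0 <= x <= j1 -> j0 <= h x - IZR k <= j1 /\
      Rabs (h x - IZR k - y) <= mu ^ n * (j1 - j0).
Proof.
  intros HG (H0 & H1 & Hmu & g1 & g2 & k1 & k2 & c & G1 & G2 & B1 & B2).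
  rewrite Forall_forall in HG. induction n as [|n IH]; intros y Hy.
  (* The identity is no word, so the base case applies one map that keeps [j0, j1]. *)
  - exists g1, k1. split; [apply sg_gen; auto|]. intros x Hx.
    destruct B1 as (B1 & _). destruct (B1 x Hx) as (Bx & _).
    split; [lra|]. simpl. apply Rabs_le; lra.
  - assert (S : exists g k z, In g Gs /\ i0 <= z <= i1 /\ forall x, j0 <= x <= j1 ->
      j0 <= g x - IZR k <= j1 /\ Rabs (g x - IZR k - y) <= mu * Rabs (x - z)).
    { destruct (Rle_dec y c) as [L|L].
      - destruct (branch_step mu j0 j1 i0 i1 i0 c g1 k1) with (y := y) as (z & Hz & E);
          auto; try lra. exists g1, k1, z; auto.
      - destruct (branch_step mu j0 j1 i0 i1 c i1 g2 k2) with (y := y) as (z & Hz & E);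
          auto; try lra. exists g2, k2, z; auto. }
    destruct S as (g & k & z & Gg & Hz & E).
    destruct (IH z Hz) as (h & k' & Hh & Eh).
    exists (fun x => g (h x)), (k + k')%Z. split; [apply sg_comp; auto|].
    intros x Hx. destruct (Eh x Hx) as (E1 & E2).
    destruct (E _ E1) as (E3 & E4).
    assert (Eg : g (h x) = g (h x - IZR k') + IZR k').
    { rewrite <- C1lift_Z by auto. f_equal; ring. }
    rewrite Eg, plus_IZR.
    replace (g (h x - IZR k') + IZR k' - (IZR k + IZR k'))
      with (g (h x - IZR k') - IZR k) by ring.
    split; auto. eapply Rle_trans; [exact E4|]. simpl. rewrite Rmult_assoc.
    apply Rmult_le_compat_l; lra.
Qed.

(** By density [V] contains, up to an integer, some h z with [z] in the core. The blender steers [x]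
    close to [z], and continuity of [h] carries it into [V]. *)
Lemma blender_orbit mu j0 j1 i0 i1 lam Gs : List.Forall C1lift Gs -> 1 < lam ->
  blender 0 mu j0 j1 i0 i1 Gs ->
  (forall y, bgood Gs i0 i1 y \/ bexp Gs i0 i1 lam y) ->
  forall x (k : Z) V, j0 <= x - IZR k <= j1 -> circ_open V -> (exists y, V y) ->
  exists h, in_sg Gs h /\ V (h x).
Proof.
  intros HG Hl HB H x k V Hx (Vp & Vo) (v & Hv).
  destruct (Vo v Hv) as (e & He & Hve).
  destruct (bgood_dense Gs i0 i1 lam HG Hl H v (v + e / 2))
    as (y & Hy & h & z & k' & Hh & Hz & Ez); [lra|].
  assert (Vy : V y) by (apply Hve; rewrite Rabs_pos_eq; lra).
  destruct (Vo y Vy) as (e' & He' & Hve').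
  assert (Lh : C1lift h) by (eapply in_sg_C1lift; eauto).
  destruct (C1lift_cont h Lh z e' He') as (d & Hd & Hc).
  destruct HB as (B0 & B1 & Hmu & B).
  assert (0 < j1 - j0 + 1) by lra.
  destruct (pow_lt_1_zero mu) with (y := d / (j1 - j0 + 1)) as (N & HN).
  { rewrite Rabs_pos_eq; lra. } { apply Rdiv_lt_0_compat; lra. }
  specialize (HN N (le_n N)). rewrite Rabs_pos_eq in HN by (apply pow_le; lra).
  destruct (blender_pow mu j0 j1 i0 i1 Gs HG ltac:(repeat (split; auto)) N z)
    as (h1 & k1 & Hh1 & E1); [lra|].
  destruct (E1 (x - IZR k) Hx) as (_ & E2).
  exists (fun x => h (h1 x)); split; [apply in_sg_comp; auto|].
  assert (L1 : C1lift h1) by (eapply in_sg_C1lift; eauto).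
  set (w := h1 (x - IZR k) - IZR k1) in *.
  assert (Ew : h1 x = w + IZR (k1 + k)).
  { unfold w. rewrite plus_IZR. replace x with (x - IZR k + IZR k) at 1 by ring.
    rewrite C1lift_Z by auto. ring. }
  rewrite Ew, C1lift_Z by auto. apply periodic_Z; auto.
  replace (h w) with (h w - IZR k' + IZR k') by ring. apply periodic_Z; auto.
  apply Hve'. replace (h w - IZR k' - y) with (h w - h z) by lra. apply Hc.
  eapply Rle_lt_trans; [exact E2|].
  assert (0 <= mu ^ N) by (apply pow_le; lra).
  apply (Rmult_lt_compat_r (j1 - j0 + 1)) in HN; [|lra].
  replace (d / (j1 - j0 + 1) * (j1 - j0 + 1)) with d in HN by (field; lra). nra.
Qed.

Lemma minimal_of_blender mu j0 j1 i0 i1 lam Gs : List.Forall C1lift Gs -> 1 < lam ->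
  blender 0 mu j0 j1 i0 i1 Gs ->
  (forall y, bgood Gs i0 i1 y \/ bexp Gs i0 i1 lam y) ->
  (forall x, fgood Gs j0 j1 x) -> minimal Gs.
Proof.
  intros HG Hl HB Hb Hf x V HV NV. destruct (Hf x) as (h & k & Hh & Hx).
  destruct (blender_orbit mu j0 j1 i0 i1 lam Gs HG Hl HB Hb (h x) k V) as (h' & Hh' & H);
    auto; [lra|].
  exists (fun x => h' (h x)); split; auto. apply in_sg_comp; auto.
Qed.

(** In contrast to minimality, it is enough that a dense set of starting points enters [j0, j1]. *)
Lemma transitive_of_blender mu j0 j1 i0 i1 lam Gs : List.Forall C1lift Gs -> 1 < lam ->
  blender 0 mu j0 j1 i0 i1 Gs ->
  (forall y, bgood Gs i0 i1 y \/ bexp Gs i0 i1 lam y) ->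
  (forall x, fgood Gs j0 j1 x \/ fexp Gs j0 j1 lam x) -> transitive Gs.
Proof.
  intros HG Hl HB Hb Hf U V (_ & Uo) (u & Hu) HV NV.
  destruct (Uo u Hu) as (e & He & Hue).
  destruct (fgood_dense Gs j0 j1 lam HG Hl Hf u (u + e / 2))
    as (x & Hx & h & k & Hh & Hhx); [lra|].
  destruct (blender_orbit mu j0 j1 i0 i1 lam Gs HG Hl HB Hb (h x) k V) as (h' & Hh' & H);
    auto; [lra|].
  exists (fun x => h' (h x)), x; split; [apply in_sg_comp; auto|]. split; auto.
  apply Hue. rewrite Rabs_pos_eq; lra.
Qed.

(** * Persistence under perturbation *)

Definition persists (Fs : list (R -> R)) (Q : list (R -> R) -> R -> Prop) (x : R) : Prop :=
  exists d, 0 < d /\ forall Gs y, List.Forall C1lift Gs -> fam_close d Fs Gs ->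
    Rabs (y - x) < d -> Q Gs y.

(** Point and family vary together in [persists], so each radius serves a whole neighbourhood;
    finitely many of these cover one period, and translation invariance of [Q] does the rest. *)
Lemma persists_uniform Fs Q :
  (forall Gs (k : Z) y, List.Forall C1lift Gs -> Q Gs y -> Q Gs (y + IZR k)) ->
  (forall x, persists Fs Q x) ->
  exists d, 0 < d /\ forall Gs, List.Forall C1lift Gs -> fam_close d Fs Gs -> forall y, Q Gs y.
Proof.
  intros HZ HP.
  destruct (compact_induction (fun a b => exists d, 0 < d /\ forall Gs y,
    List.Forall C1lift Gs -> fam_close d Fs Gs -> a <= y <= b -> Q Gs y)) with (a := 0) (b := 1)
    as (d & Hd & H); [| |lra|].
  - intros x. destruct (HP x) as (d & Hd & H). exists d; split; auto.
    intros a b Ha Hab Hb. exists d; split; auto. intros Gs y HG HC Hy.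
    apply H; auto. apply Rabs_def1; lra.
  - intros a b c _ _ (d1 & Hd1 & H1) (d2 & Hd2 & H2).
    exists (Rmin d1 d2); split; [apply Rmin_pos; auto|]. intros Gs y HG HC Hy.
    destruct (Rle_dec y b).
    + apply H1; auto; [|lra]. eapply fam_close_le; [apply Rmin_l|exact HC].
    + apply H2; auto; [|lra]. eapply fam_close_le; [apply Rmin_r|exact HC].
  - exists d; split; auto. intros Gs HG HC y.
    destruct (exists_floor y) as (k & Hk). replace y with (y - IZR k + IZR k) by ring.
    apply HZ; auto. apply H; auto; lra.
Qed.

Lemma fgood_persists Fs j0 j1 x : List.Forall C1lift Fs -> fgood Fs j0 j1 x ->
  persists Fs (fun Gs => fgood Gs j0 j1) x.
Proof.
  intros HF (h & k & Hh & Hx).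
  assert (Lh : C1lift h) by (eapply in_sg_C1lift; eauto).
  set (e := Rmin (h x - IZR k - j0) (j1 - (h x - IZR k)) / 2).
  assert (He : 0 < e).
  { unfold e. apply Rdiv_lt_0_compat; [apply Rmin_pos|]; lra. }
  assert (E1 : 2 * e <= h x - IZR k - j0) by (unfold e; generalize (Rmin_l (h x - IZR k - j0) (j1 - (h x - IZR k))); lra).
  assert (E2 : 2 * e <= j1 - (h x - IZR k)) by (unfold e; generalize (Rmin_r (h x - IZR k - j0) (j1 - (h x - IZR k))); lra).
  clearbody e.
  destruct (C1lift_cont h Lh x e He) as (d1 & Hd1 & Hc).
  destruct (sg_close Fs h HF Hh e He) as (d2 & Hd2 & Hs).
  exists (Rmin d1 d2); split; [apply Rmin_pos; auto|].
  intros Gs y HG HC Hy.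
  destruct (Hs Gs HG) as (h' & Hh' & m & C).
  { eapply fam_close_le; [apply Rmin_r|exact HC]. }
  exists h', (k + m)%Z; split; auto. rewrite plus_IZR.
  destruct (C y) as (C1 & _). apply Rabs_def2 in C1.
  assert (B : Rabs (h y - h x) < e).
  { apply Hc. eapply Rlt_le_trans; [exact Hy|apply Rmin_l]. }
  apply Rabs_def2 in B. lra.
Qed.

(** The preimage [z] may move: points [z1] and [z2] of the core on its two sides still have images
    enclosing the target, and the intermediate value theorem finds a new preimage. *)
Lemma bgood_persists Fs i0 i1 y : List.Forall C1lift Fs -> bgood Fs i0 i1 y ->
  persists Fs (fun Gs => bgood Gs i0 i1) y.
Proof.
  intros HF (h & z & k & Hh & Hz & Ez).
  assert (Lh : C1lift h) by (eapply in_sg_C1lift; eauto).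
  set (z1 := (i0 + z) / 2). set (z2 := (z + i1) / 2).
  assert (Z : i0 < z1 < z /\ z < z2 < i1) by (unfold z1, z2; lra).
  clearbody z1 z2.
  assert (M1 : h z1 < h z) by (apply C1lift_lt; auto; lra).
  assert (M2 : h z < h z2) by (apply C1lift_lt; auto; lra).
  set (e := Rmin (h z - h z1) (h z2 - h z) / 2).
  assert (He : 0 < e).
  { unfold e. apply Rdiv_lt_0_compat; [apply Rmin_pos|]; lra. }
  assert (E1 : 2 * e <= h z - h z1) by (unfold e; generalize (Rmin_l (h z - h z1) (h z2 - h z)); lra).
  assert (E2 : 2 * e <= h z2 - h z) by (unfold e; generalize (Rmin_r (h z - h z1) (h z2 - h z)); lra).
  clearbody e.
  destruct (sg_close Fs h HF Hh e He) as (d2 & Hd2 & Hs).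
  exists (Rmin e d2); split; [apply Rmin_pos; auto|].
  intros Gs y' HG HC Hy.
  destruct (Hs Gs HG) as (h' & Hh' & m & C).
  { eapply fam_close_le; [apply Rmin_r|exact HC]. }
  assert (Hy' : Rabs (y' - y) < e) by (eapply Rlt_le_trans; [exact Hy|apply Rmin_l]).
  apply Rabs_def2 in Hy'.
  destruct (C z1) as (C1 & _). apply Rabs_def2 in C1.
  destruct (C z2) as (C2 & _). apply Rabs_def2 in C2.
  destruct (C1lift_IVT h') with (a := z1) (b := z2) (y := y' + IZR (k + m))
    as (x & Hx & Ex).
  { eapply in_sg_C1lift; eauto. } { lra. } { rewrite plus_IZR; lra. }
  exists h', x, (k + m)%Z; split; auto. split; [lra|auto].
Qed.

(** [p] and [q] are kept and stay good; only the expansion rate has to give way, hence the two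
    rates. *)
Lemma fexp_persists Fs j0 j1 lam lam' x : List.Forall C1lift Fs -> lam' < lam ->
  fexp Fs j0 j1 lam x -> persists Fs (fun Gs => fexp Gs j0 j1 lam') x.
Proof.
  intros HF Hl (p & q & h & Hx & Gp & Gq & Hh & D).
  destruct (fgood_persists _ _ _ _ HF Gp) as (d1 & Hd1 & H1).
  destruct (fgood_persists _ _ _ _ HF Gq) as (d2 & Hd2 & H2).
  destruct (sg_close Fs h HF Hh (lam - lam')) as (d3 & Hd3 & H3); [lra|].
  set (d := Rmin (Rmin d1 d2) (Rmin d3 (Rmin (x - p) (q - x)))).
  assert (Bd : d <= d1 /\ d <= d2 /\ d <= d3 /\ d <= x - p /\ d <= q - x).
  { unfold d. Rmin_bounds. repeat split; lra. }
  exists d; split. { unfold d; repeat apply Rmin_pos; lra. }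
  clearbody d. intros Gs y HG HC Hy. apply Rabs_def2 in Hy.
  destruct (H3 Gs HG) as (h' & Hh' & m & C).
  { eapply fam_close_le; [|exact HC]; lra. }
  exists p, q, h'. split; [lra|]. split; [|split; [|split; auto]].
  - apply H1; auto; [eapply fam_close_le; [|exact HC]; lra|].
    rewrite Rminus_diag, Rabs_R0; auto.
  - apply H2; auto; [eapply fam_close_le; [|exact HC]; lra|].
    rewrite Rminus_diag, Rabs_R0; auto.
  - intros z Hz. destruct (C z) as (_ & Cz). apply Rabs_def2 in Cz.
    specialize (D z Hz). lra.
Qed.

Lemma bexp_persists Fs i0 i1 lam lam' y : List.Forall C1lift Fs -> 1 < lam' < lam ->
  bexp Fs i0 i1 lam y -> persists Fs (fun Gs => bexp Gs i0 i1 lam') y.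
Proof.
  intros HF Hl (h & p & q & k & Hh & Hpq & Hy & Gp & Gq & D).
  destruct (bgood_persists _ _ _ _ HF Gp) as (d1 & Hd1 & H1).
  destruct (bgood_persists _ _ _ _ HF Gq) as (d2 & Hd2 & H2).
  assert (HD : 0 < / lam' - / lam).
  { apply Rlt_0_minus, Rinv_lt_contravar; [apply Rmult_lt_0_compat|]; lra. }
  set (e := Rmin (Rmin d1 d2) (Rmin (/ lam' - / lam)
    (Rmin ((y + IZR k - h p) / 2) ((h q - (y + IZR k)) / 2)))).
  assert (He : 0 < e) by (unfold e; repeat apply Rmin_pos; lra).
  assert (Be : e <= d1 /\ e <= d2 /\ e <= / lam' - / lam /\
     e <= (y + IZR k - h p) / 2 /\ e <= (h q - (y + IZR k)) / 2).
  { unfold e. Rmin_bounds. repeat split; lra. }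
  clearbody e.
  destruct (sg_close Fs h HF Hh e He) as (d3 & Hd3 & H3).
  exists (Rmin e d3); split; [apply Rmin_pos; auto|].
  assert (M1 := Rmin_l e d3). assert (M2 := Rmin_r e d3).
  set (d := Rmin e d3) in *. clearbody d.
  intros Gs y' HG HC Hy'. apply Rabs_def2 in Hy'.
  destruct (H3 Gs HG) as (h' & Hh' & m & C).
  { eapply fam_close_le; [|exact HC]; lra. }
  destruct (C p) as (Cp & _). destruct (C q) as (Cq & _).
  assert (X : forall x, bgood Gs i0 i1 (h' x - IZR m) -> bgood Gs i0 i1 (h' x)).
  { intros x B. replace (h' x) with (h' x - IZR m + IZR m) by ring. apply bgood_Z; auto. }
  exists h', p, q, (k + m)%Z. split; auto. split; auto. rewrite plus_IZR.
  split; [|split; [|split]].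
  - apply Rabs_def2 in Cp, Cq. lra.
  - apply X, H1; auto; [eapply fam_close_le; [|exact HC]; lra|].
    replace (h' p - IZR m - h p) with (h' p - h p - IZR m) by ring. lra.
  - apply X, H2; auto; [eapply fam_close_le; [|exact HC]; lra|].
    replace (h' q - IZR m - h q) with (h' q - h q - IZR m) by ring. lra.
  - intros z Hz. destruct (C z) as (_ & Cz). apply Rabs_def2 in Cz.
    specialize (D z Hz).
    assert (B : Derive h z <= / lam).
    { apply (Rmult_le_reg_l lam); [lra|]. rewrite Rinv_r; lra. }
    apply Rle_trans with (lam' * / lam'); [|rewrite Rinv_r; lra].
    apply Rmult_le_compat_l; lra.
Qed.

Lemma robust_transitivity eta mu j0 j1 i0 i1 lam Fs :
  List.Forall C1lift Fs -> 0 < eta -> 1 < lam -> blender eta mu j0 j1 i0 i1 Fs ->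
  (forall y, bgood Fs i0 i1 y \/ bexp Fs i0 i1 lam y) ->
  (forall x, fgood Fs j0 j1 x \/ fexp Fs j0 j1 lam x) ->
  exists d, 0 < d /\ forall Gs, List.Forall C1lift Gs -> fam_close d Fs Gs -> transitive Gs.
Proof.
  intros HF Heta Hl HB Hb Hf.
  (* Half of the excess over 1 is left to the perturbation. *)
  set (lam' := (1 + lam) / 2). assert (Hl' : 1 < lam' < lam) by (unfold lam'; lra).
  clearbody lam'.
  destruct (persists_uniform Fs (fun Gs y => bgood Gs i0 i1 y \/ bexp Gs i0 i1 lam' y))
    as (d1 & Hd1 & H1).
  { intros Gs k y _ [H|H]; [left; apply bgood_Z|right; apply bexp_Z]; auto. }
  { intros y. destruct (Hb y) as [H|H].
    - destruct (bgood_persists _ _ _ _ HF H) as (d & Hd & P).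
      exists d; split; [exact Hd|]. intros; left; apply P; auto.
    - destruct (bexp_persists _ _ _ _ _ _ HF Hl' H) as (d & Hd & P).
      exists d; split; [exact Hd|]. intros; right; apply P; auto. }
  destruct (persists_uniform Fs (fun Gs y => fgood Gs j0 j1 y \/ fexp Gs j0 j1 lam' y))
    as (d2 & Hd2 & H2).
  { intros Gs k y HG [H|H]; [left; apply fgood_Z|right; apply fexp_Z]; auto. }
  { intros y. destruct (Hf y) as [H|H].
    - destruct (fgood_persists _ _ _ _ HF H) as (d & Hd & P).
      exists d; split; [exact Hd|]. intros; left; apply P; auto.
    - destruct (fexp_persists _ _ _ _ lam' _ HF (proj2 Hl') H) as (d & Hd & P).
      exists d; split; [exact Hd|]. intros; right; apply P; auto. }
  exists (Rmin eta (Rmin d1 d2)); split; [repeat apply Rmin_pos; auto|].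
  intros Gs HG HC.
  apply (transitive_of_blender mu j0 j1 i0 i1 lam'); auto; try lra.
  - eapply blender_close; [exact HB|]. eapply fam_close_le; [apply Rmin_l|exact HC].
  - apply H1; auto. eapply fam_close_le; [|exact HC].
    eapply Rle_trans; [apply Rmin_r|apply Rmin_l].
  - apply H2; auto. eapply fam_close_le; [|exact HC].
    eapply Rle_trans; [apply Rmin_r|apply Rmin_r].
Qed.

(** * The metric controls values and first derivatives *)

(** [real] turns an infinite supremum into 0, so boundedness must be known before the supremum
    dominates anything. *)
Lemma sup_R_ub (E : R -> Prop) M y : (forall z, E z -> z <= M) -> E y -> y <= sup_R E.
Proof.
  intros HM Hy. unfold sup_R. destruct (Lub_Rbar_correct E) as (U & L).
  specialize (U y Hy). specialize (L (Finite M) (fun z Hz => HM z Hz)).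
  destruct (Lub_Rbar E); simpl in *; auto; contradiction.
Qed.

Lemma sup_R_pos (E : R -> Prop) y : (forall z, E z -> 0 <= z) -> E y -> 0 <= sup_R E.
Proof.
  intros H Hy. unfold sup_R. destruct (Lub_Rbar_correct E) as (U & _).
  specialize (U y Hy). destruct (Lub_Rbar E); simpl in *; try lra.
  specialize (H y Hy); lra.
Qed.

Lemma dist_circ_bounds a b : 0 <= dist_circ a b <= 1.
Proof.
  unfold dist_circ. destruct (base_fp (a - b)) as (H1 & H2).
  split; [apply Rmin_glb; lra|]. eapply Rle_trans; [apply Rmin_l|lra].
Qed.

Lemma dist_circ_Z a b e : dist_circ a b < e -> exists k : Z, Rabs (b - a - IZR k) < e.
Proof.
  unfold dist_circ. intros H. generalize (Rplus_Int_part_frac_part (a - b)).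
  destruct (base_fp (a - b)) as (H1 & H2). intros E.
  unfold Rmin in H. destruct Rle_dec.
  - exists (- Int_part (a - b))%Z. rewrite opp_IZR. apply Rabs_def1; lra.
  - exists (- Int_part (a - b) - 1)%Z. rewrite minus_IZR, opp_IZR. apply Rabs_def1; lra.
Qed.

Lemma dj_pos f g j : 0 <= dj f g j.
Proof.
  destruct j as [|j]; simpl; eapply sup_R_pos; try (exists 0; reflexivity).
  - intros z (x & ->). apply dist_circ_bounds.
  - intros z (x & ->). apply Rabs_pos.
Qed.

Lemma ex_series_dr f g : ex_series (fun j => (/ 2) ^ j * Rmin 1 (dj f g j)).
Proof.
  apply (ex_series_le (K := R_AbsRing) (V := R_CompleteNormedModule)) with (fun j => (/ 2) ^ j).
  - intros n. change norm with Rabs.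
    assert (0 < (/ 2) ^ n) by (apply pow_lt; lra).
    assert (B := dj_pos f g n). assert (M := Rmin_l 1 (dj f g n)).
    assert (P : 0 <= Rmin 1 (dj f g n)) by (apply Rmin_glb; lra).
    rewrite Rabs_pos_eq by (apply Rmult_le_pos; lra). nra.
  - apply ex_series_geom. rewrite Rabs_pos_eq; lra.
Qed.

Lemma Series_pos (a : nat -> R) : (forall n, 0 <= a n) -> ex_series a -> 0 <= Series a.
Proof.
  intros Ha Ea. rewrite <- (Rmult_0_l (Series a)), <- Series_scal_l.
  apply Series_le; auto. intros n. specialize (Ha n). lra.
Qed.

Lemma dr_pos r f g : 0 <= dr r f g.
Proof.
  destruct r as [m|]; simpl.
  - apply cond_pos_sum. intros; apply dj_pos.
  - apply Series_pos; [|apply ex_series_dr]. intros n.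
    apply Rmult_le_pos; [apply pow_le; lra|]. apply Rmin_glb; [lra|apply dj_pos].
Qed.

(** For infinite [r] the terms of order 0 and 1 have weights 1 and 1/2 and are truncated at 1. The
    bound on [e] excludes truncation, and the weight 1/2 costs the factor 2. *)
Lemma dr_lt_dj r f g e : le_reg 1 r -> e <= / 2 -> dr r f g < e ->
  dj f g 0 < e /\ dj f g 1 < 2 * e.
Proof.
  intros Hr He H. destruct r as [m|]; simpl in Hr, H.
  - assert (S : forall n, sum_f_R0 (dj f g) 1 <= sum_f_R0 (dj f g) (S n)).
    { induction n as [|n IH]; [lra|]. rewrite (tech5 _ (S n)). generalize (dj_pos f g (S (S n))). lra. }
    destruct m as [|m]; [lia|]. specialize (S m). change (sum_f_R0 (dj f g) 1) with (dj f g 0 + dj f g 1) in S.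
    generalize (dj_pos f g 0) (dj_pos f g 1). lra.
  - set (a := fun j => (/ 2) ^ j * Rmin 1 (dj f g j)) in H.
    assert (Ea : ex_series a) by apply ex_series_dr.
    assert (Ea1 : ex_series (fun n => a (S n))) by (apply (ex_series_incr_1 a); auto).
    rewrite Series_incr_1 in H by auto. rewrite Series_incr_1 in H by auto.
    assert (P : 0 <= Series (fun k => a (S (S k)))).
    { apply Series_pos.
      - intros n. unfold a. apply Rmult_le_pos; [apply pow_le; lra|].
        apply Rmin_glb; [lra|apply dj_pos].
      - apply (ex_series_incr_1 (fun n => a (S n))); auto. }
    assert (Ea0 : a 0%nat = Rmin 1 (dj f g 0)) by (unfold a; simpl pow; ring).
    assert (Eb0 : a 1%nat = / 2 * Rmin 1 (dj f g 1)) by (unfold a; simpl pow; ring).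
    generalize (dj_pos f g 0) (dj_pos f g 1). intros P0 P1.
    unfold Rmin in Ea0, Eb0. repeat destruct Rle_dec; lra.
Qed.

(** The continuous function g - f stays away from half-integers, so by the intermediate value
    theorem its nearest integer cannot change from point to point. *)
Lemma close_of_pointwise e f g : C1lift f -> C1lift g -> e <= / 4 ->
  (forall x, exists k : Z, Rabs (g x - f x - IZR k) < e) ->
  (forall x, Rabs (Derive g x - Derive f x) < e) -> close e f g.
Proof.
  intros Hf Hg He H0 H1. destruct (H0 0) as (k & Hk). exists k. intros x. split; auto.
  destruct (H0 x) as (m & Hm).
  destruct (Z.eq_dec k m) as [->|N]; auto. exfalso.
  assert (C : continuity (fun x => g x - f x)).
  { intros y. apply continuity_pt_minus; apply C1lift_continuity; auto. }
  assert (exists n : Z, (k <= n < m \/ m <= n < k)%Z) as (n & Hn).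
  { exists (Z.min k m). lia. }
  assert (B : exists y, g y - f y = IZR n + / 2).
  { apply Rabs_def2 in Hk, Hm.
    destruct (IVT_gen (fun x => g x - f x) 0 x (IZR n + / 2) C) as (y & _ & Ey); [|eauto].
    destruct Hn as [(N1 & N2)|(N1 & N2)]; apply Zlt_le_succ in N2;
      apply IZR_le in N1, N2; rewrite succ_IZR in N2; unfold Rmin, Rmax;
      destruct Rle_dec; lra. }
  destruct B as (y & Ey). destruct (H0 y) as (j & Hj). rewrite Ey in Hj.
  apply Rabs_def2 in Hj.
  assert (B1 : IZR (2 * n - 2 * j) < 0) by (rewrite minus_IZR, !mult_IZR; lra).
  assert (B2 : IZR (2 * n - 2 * j) > -2) by (rewrite minus_IZR, !mult_IZR; lra).
  apply lt_IZR in B1. apply Rgt_lt, lt_IZR in B2. lia.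
Qed.

Lemma dr_close r f g e : le_reg 1 r -> lift_diff r f -> lift_diff r g -> 0 < e <= / 8 ->
  dr r f g < e -> close (2 * e) f g.
Proof.
  intros Hr Lf Lg He H.
  apply (lift_diff_C1lift _ _ Hr) in Lf, Lg.
  destruct (dr_lt_dj r f g e Hr ltac:(lra) H) as (H0 & H1).
  apply close_of_pointwise; auto; [lra| |].
  - intros x. apply dist_circ_Z. eapply Rle_lt_trans; [|apply (Rlt_trans _ e); [exact H0|lra]].
    apply (sup_R_ub _ 1); [|exists x; reflexivity].
    intros z (y & ->). apply dist_circ_bounds.
  - intros x. rewrite Rabs_minus_sym. eapply Rle_lt_trans; [|exact H1].
    destruct (C1lift_Derive_bound f Lf) as (M & HM & BM).
    destruct (C1lift_Derive_bound g Lg) as (N & HN & BN).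
    apply (sup_R_ub _ (M + N)); [|exists x; reflexivity].
    intros z (y & ->). simpl Derive_n. apply Rabs_le.
    assert (0 < Derive f y) by apply Lf. assert (0 < Derive g y) by apply Lg.
    specialize (BM y). specialize (BN y).
    change (Derive (fun x => f x) y) with (Derive f y).
    change (Derive (fun x => g x) y) with (Derive g y). lra.
Qed.

Lemma fam_dist_pos r Fs Gs : 0 <= fam_dist r Fs Gs.
Proof.
  unfold fam_dist. induction (combine Fs Gs) as [|p l IH]; simpl; [lra|].
  generalize (dr_pos r (fst p) (snd p)). lra.
Qed.

Lemma fam_dist_In r Fs : forall Gs e, length Fs = length Gs -> fam_dist r Fs Gs < e ->
  forall f, In f Fs -> exists g, In g Gs /\ dr r f g < e.
Proof.
  induction Fs as [|f0 Fs IH]; intros [|g0 Gs] e HL H f Hf; simpl in *; try lia; try tauto.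
  unfold fam_dist in H; simpl in H. fold (fam_dist r Fs Gs) in H.
  destruct Hf as [<-|Hf].
  - exists g0; split; auto. generalize (fam_dist_pos r Fs Gs). lra.
  - destruct (IH Gs e) with (f := f) as (g & Hg & Hd); auto.
    + generalize (dr_pos r f0 g0). lra.
    + eauto.
Qed.

Lemma dbar_fam_close r k Fs Gs e : le_reg 1 r -> IFS r k Fs -> IFS r k Gs -> 0 < e <= / 8 ->
  dbar_lt r Fs Gs e -> fam_close (2 * e) Fs Gs.
Proof.
  intros Hr (LF & HF) (LG & HG) He (Gs' & HP & HD) f Hf.
  destruct (fam_dist_In r Fs Gs' e) with (f := f) as (g & Hg & Hd); auto.
  { rewrite LF, <- LG. apply Permutation_length; auto. }
  apply Permutation_sym in HP. apply (Permutation_in g HP) in Hg.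
  rewrite Forall_forall in HF, HG.
  exists g; split; auto. eapply dr_close; eauto.
Qed.

Lemma IFS_C1lift r k Fs : le_reg 1 r -> IFS r k Fs -> List.Forall C1lift Fs.
Proof.
  intros Hr (_ & HF). eapply Forall_impl; [|exact HF].
  intros f. apply lift_diff_C1lift; auto.
Qed.

Lemma RT_of_blender r k eta mu j0 j1 i0 i1 lam Fs : le_reg 1 r -> IFS r k Fs ->
  0 < eta -> 1 < lam -> blender eta mu j0 j1 i0 i1 Fs ->
  (forall y, bgood Fs i0 i1 y \/ bexp Fs i0 i1 lam y) ->
  (forall x, fgood Fs j0 j1 x \/ fexp Fs j0 j1 lam x) -> RT r k Fs.
Proof.
  intros Hr HI Heta Hl HB Hb Hf. split; auto.
  destruct (robust_transitivity eta mu j0 j1 i0 i1 lam Fs) as (d & Hd & H); auto.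
  { eapply IFS_C1lift; eauto. }
  (* Distance below e yields closeness 2e, hence the halving; 1/8 is the range of that
     comparison. *)
  exists (Rmin (d / 2) (/ 8)). split; [apply Rmin_pos; lra|].
  intros Gs HG HD. apply H; [eapply IFS_C1lift; eauto|].
  eapply fam_close_le; [|eapply (dbar_fam_close r k); eauto].
  - generalize (Rmin_l (d / 2) (/ 8)). lra.
  - split; [apply Rmin_pos; lra|apply Rmin_r].
Qed.

(** * Smooth functions and the smooth step *)

(** Descending through [Derive] lets products and reciprocals be treated by induction on [n],
    without a Leibniz formula. *)
Fixpoint smooth_n (n : nat) (f : R -> R) : Prop :=
  match n with
  | O => forall x, continuous f x
  | S m => (forall x, ex_derive f x) /\ smooth_n m (Derive f)
  end.

Definition smooth (f : R -> R) : Prop := forall n, smooth_n n f.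

Lemma smooth_n_S n : forall f, smooth_n (S n) f -> smooth_n n f.
Proof.
  induction n as [|n IH]; intros f (H1 & H2).
  - intros x. apply (ex_derive_continuous f), H1.
  - split; auto.
Qed.

Lemma smooth_n_derive n f f' : (forall x, is_derive f x (f' x)) -> smooth_n n f' ->
  smooth_n (S n) f.
Proof.
  intros H H'. split; [intros x; exists (f' x); apply H|].
  replace (Derive f) with f'; auto.
  apply functional_extensionality. intros x. symmetry. apply is_derive_unique, H.
Qed.

Lemma smooth_n_const n : forall c, smooth_n n (fun _ => c).
Proof.
  induction n as [|n IH]; intros c.
  - intros x. apply continuous_const.
  - apply (smooth_n_derive n _ (fun _ => 0)); auto. intros x. apply (is_derive_const c).
Qed.

Lemma smooth_n_id n : smooth_n n (fun x => x).
Proof.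
  destruct n as [|n].
  - intros x. apply continuous_id.
  - apply (smooth_n_derive n _ (fun _ => 1)); [|apply smooth_n_const].
    intros x. apply (is_derive_id x).
Qed.

Lemma smooth_n_plus n : forall f g, smooth_n n f -> smooth_n n g ->
  smooth_n n (fun x => f x + g x).
Proof.
  induction n as [|n IH]; intros f g Hf Hg.
  - intros x. apply (continuous_plus f g); auto.
  - destruct Hf as (Hf & Hf'), Hg as (Hg & Hg').
    apply (smooth_n_derive n _ (fun x => Derive f x + Derive g x)); [|apply IH; auto].
    intros x. apply (is_derive_plus f g); apply Derive_correct; auto.
Qed.

Lemma smooth_n_mult n : forall f g, smooth_n n f -> smooth_n n g ->
  smooth_n n (fun x => f x * g x).
Proof.
  induction n as [|n IH]; intros f g Hf Hg.
  - intros x. apply (continuous_mult f g); auto.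
  - assert (Hf0 := smooth_n_S _ _ Hf). assert (Hg0 := smooth_n_S _ _ Hg).
    destruct Hf as (Hf & Hf'), Hg as (Hg & Hg').
    apply (smooth_n_derive n _ (fun x => Derive f x * g x + f x * Derive g x)).
    + intros x. apply (is_derive_mult f g); try (apply Derive_correct; auto).
      intros; apply Rmult_comm.
    + apply smooth_n_plus; apply IH; auto.
Qed.

Lemma smooth_n_inv n : forall f, (forall x, f x <> 0) -> smooth_n n f ->
  smooth_n n (fun x => / f x).
Proof.
  induction n as [|n IH]; intros f Hn Hf.
  - intros x. apply (continuous_Rinv_comp f); auto.
  - assert (Hf0 := smooth_n_S _ _ Hf). destruct Hf as (Hf & Hf').
    apply (smooth_n_derive n _ (fun x => -1 * (Derive f x * (/ f x * / f x)))).
    + intros x.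
      replace (-1 * (Derive f x * (/ f x * / f x))) with (- Derive f x / f x ^ 2) by (field; auto).
      apply is_derive_inv; auto. apply Derive_correct; auto.
    + apply smooth_n_mult; [apply smooth_n_const|].
      apply smooth_n_mult; auto. apply smooth_n_mult; apply IH; auto.
Qed.

Lemma smooth_n_affine n : forall f a b, smooth_n n f -> smooth_n n (fun x => f (a * x + b)).
Proof.
  induction n as [|n IH]; intros f a b Hf.
  - intros x. apply (continuous_comp (fun x => a * x + b) f); auto.
    apply (ex_derive_continuous (fun x => a * x + b)). auto_derive; auto.
  - destruct Hf as (Hf & Hf').
    apply (smooth_n_derive n _ (fun x => a * Derive f (a * x + b))).
    + intros x. apply (is_derive_comp f (fun x => a * x + b)).
      * apply Derive_correct; auto.
      * auto_derive; auto; ring.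
    + apply smooth_n_mult; [apply smooth_n_const|apply IH; auto].
Qed.

Lemma smooth_const c : smooth (fun _ => c).
Proof. intros n; apply smooth_n_const. Qed.

Lemma smooth_id : smooth (fun x => x).
Proof. intros n; apply smooth_n_id. Qed.

Lemma smooth_plus f g : smooth f -> smooth g -> smooth (fun x => f x + g x).
Proof. intros Hf Hg n; apply smooth_n_plus; auto. Qed.

Lemma smooth_mult f g : smooth f -> smooth g -> smooth (fun x => f x * g x).
Proof. intros Hf Hg n; apply smooth_n_mult; auto. Qed.

Lemma smooth_inv f : (forall x, f x <> 0) -> smooth f -> smooth (fun x => / f x).
Proof. intros Hn Hf n; apply smooth_n_inv; auto. Qed.

Lemma smooth_affine f a b : smooth f -> smooth (fun x => f (a * x + b)).
Proof. intros Hf n; apply smooth_n_affine; auto. Qed.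

Lemma smooth_ext f g : (forall x, f x = g x) -> smooth f -> smooth g.
Proof. intros H. replace g with f; auto. apply functional_extensionality, H. Qed.

Lemma smooth_ex_derive f x : smooth f -> ex_derive f x.
Proof. intros Hf. apply (Hf 1%nat). Qed.

Lemma smooth_Derive_n f n : smooth f -> smooth (Derive_n f n).
Proof.
  intros Hf m. assert (H := Hf (n + m)%nat). clear Hf. revert f H.
  induction n as [|n IH]; intros f H; [exact H|].
  replace (Derive_n f (S n)) with (Derive_n (Derive f) n).
  - apply IH, H.
  - apply functional_extensionality. intros x.
    change (Derive_n (Derive_n f 1) n x = Derive_n f (S n) x).
    rewrite Derive_n_comp. f_equal. lia.
Qed.

(** Maps made by [per] are given by different formulas on different periods; it suffices that they
    agree near each point with some smooth function. *)
Lemma Cr_local r F :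
  (forall x, exists G, smooth G /\ locally x (fun y => G y = F y)) -> Cr r F.
Proof.
  intros H n _ x. destruct (H x) as (G & HG & L). split.
  - apply (ex_derive_n_ext_loc G F n x L). destruct n as [|n]; simpl; auto.
    apply smooth_ex_derive, smooth_Derive_n, HG.
  - apply (continuous_ext_loc _ (Derive_n G n)).
    + apply locally_locally in L. revert L. apply filter_imp. intros y Ly.
      apply (Derive_n_ext_loc G F n y Ly).
    + apply (smooth_Derive_n G n HG 0%nat).
Qed.

(** * Functions flat at the origin *)

Lemma pow_le_exp n : exists C, 0 < C /\ forall s, 0 < s -> s ^ n <= C * exp s.
Proof.
  induction n as [|n (C & HC & H)].
  - exists 1; split; [lra|]. intros s Hs. simpl. generalize (exp_ineq1 s). lra.
  - exists (2 ^ S n * C); split.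
    { apply Rmult_lt_0_compat; auto. apply pow_lt; lra. }
    intros s Hs. specialize (H (s / 2) ltac:(lra)).
    assert (E : s / 2 <= exp (s / 2)) by (generalize (exp_ineq1_le (s / 2)); lra).
    replace (s ^ S n) with (2 ^ S n * ((s / 2) * (s / 2) ^ n)).
    2:{ change ((s / 2) * (s / 2) ^ n) with ((s / 2) ^ S n). rewrite <- Rpow_mult_distr.
        f_equal; field. }
    rewrite Rmult_assoc. apply Rmult_le_compat_l; [apply pow_le; lra|].
    replace (exp s) with (exp (s / 2) * exp (s / 2)).
    2:{ rewrite <- exp_plus. f_equal; field. }
    assert (0 < exp (s / 2)) by apply exp_pos.
    assert (0 < (s / 2) ^ n) by (apply pow_lt; lra). nra.
Qed.

(** Taking all exponents [m] at once makes the linear span closed under differentiation, as the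
    induction for smoothness requires. *)
Definition flat (m : nat) (t : R) : R :=
  if Rle_dec t 0 then 0 else (/ t) ^ m * exp (- / t).

Lemma flat_neg m t : t <= 0 -> flat m t = 0.
Proof. intros H. unfold flat. destruct Rle_dec; lra. Qed.

Lemma flat_pos m t : 0 < t -> flat m t = (/ t) ^ m * exp (- / t).
Proof. intros H. unfold flat. destruct Rle_dec; lra. Qed.

Lemma flat_gt0 m t : 0 < t -> 0 < flat m t.
Proof.
  intros H. rewrite flat_pos by auto. apply Rmult_lt_0_compat; [|apply exp_pos].
  apply pow_lt, Rinv_0_lt_compat, H.
Qed.

Lemma flat_ge0 m t : 0 <= flat m t.
Proof.
  destruct (Rle_dec t 0) as [H|H]; [rewrite flat_neg; lra|left; apply flat_gt0; lra].
Qed.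

(** Exponential growth beats the power m + 2 at s = 1/t. The quadratic bound makes the difference
    quotient at 0 vanish in the limit. *)
Lemma flat_quadratic m : exists C, 0 < C /\ forall t, Rabs (flat m t) <= C * (t * t).
Proof.
  destruct (pow_le_exp (m + 2)) as (C & HC & H). exists C; split; auto. intros t.
  rewrite Rabs_pos_eq by apply flat_ge0.
  destruct (Rle_dec t 0) as [Ht|Ht]; [rewrite flat_neg by auto; nra|].
  rewrite flat_pos by lra. assert (P : 0 < / t) by (apply Rinv_0_lt_compat; lra).
  specialize (H (/ t) P). rewrite pow_add in H.
  rewrite exp_Ropp. assert (Pe := exp_pos (/ t)).
  apply (Rmult_le_reg_r (exp (/ t) * ((/ t) ^ 2))).
  { apply Rmult_lt_0_compat; auto. apply pow_lt; auto. }
  replace ((/ t) ^ m * / exp (/ t) * (exp (/ t) * (/ t) ^ 2)) with ((/ t) ^ m * (/ t) ^ 2)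
    by (field; split; lra).
  replace (C * (t * t) * (exp (/ t) * (/ t) ^ 2)) with (C * exp (/ t)) by (field; lra).
  exact H.
Qed.

Lemma is_derive_flat m t : is_derive (flat m) t (flat (m + 2) t - INR m * flat (m + 1) t).
Proof.
  destruct (Rtotal_order t 0) as [H|[H|H]].
  - rewrite !flat_neg by lra. replace (0 - INR m * 0) with 0 by ring.
    apply (is_derive_ext_loc (fun _ => 0)); [|apply (is_derive_const 0)].
    assert (He : 0 < - t) by lra. exists (mkposreal _ He). intros y Hy.
    apply Rabs_def2 in Hy. simpl in Hy. rewrite flat_neg; auto.
    change (minus y t) with (y - t) in Hy. lra.
  - subst t. rewrite !flat_neg by lra. replace (0 - INR m * 0) with 0 by ring.
    apply is_derive_Reals. intros e He.
    destruct (flat_quadratic m) as (C & HC & B).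
    assert (Hd : 0 < e / C) by (apply Rdiv_lt_0_compat; auto).
    exists (mkposreal _ Hd). intros h Hh Hhe. simpl in Hhe.
    rewrite (flat_neg m 0), Rplus_0_l, !Rminus_0_r by lra.
    unfold Rdiv. rewrite Rabs_mult, Rabs_inv.
    assert (P : 0 < Rabs h) by (apply Rabs_pos_lt; auto).
    apply (Rmult_lt_reg_r (Rabs h)); auto.
    rewrite Rmult_assoc, Rinv_l, Rmult_1_r by lra.
    eapply Rle_lt_trans; [apply B|]. replace (h * h) with (Rabs h * Rabs h).
    2:{ rewrite <- Rabs_mult. apply Rabs_pos_eq. nra. }
    rewrite <- Rmult_assoc. apply Rmult_lt_compat_r; auto.
    apply (Rmult_lt_compat_l C) in Hhe; auto.
    replace (C * (e / C)) with e in Hhe by (field; lra). auto.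
  - apply (is_derive_ext_loc (fun t => (/ t) ^ m * exp (- / t))).
    { exists (mkposreal _ H). intros y Hy. apply Rabs_def2 in Hy. simpl in Hy.
      change (minus y t) with (y - t) in Hy. rewrite flat_pos; auto. lra. }
    rewrite !flat_pos, !pow_add by auto.
    auto_derive; [lra|]. destruct m as [|m]; [simpl; field; lra|].
    simpl Nat.pred. simpl pow. field. lra.
Qed.

Lemma smooth_flat m : smooth (flat m).
Proof.
  intros n. revert m. induction n as [|n IH]; intros m.
  - intros x. apply (ex_derive_continuous (flat m)). eexists; apply is_derive_flat.
  - eapply smooth_n_derive; [apply is_derive_flat|].
    apply smooth_n_plus; auto.
    replace (fun x => - (INR m * flat (m + 1) x)) with (fun x => - INR m * flat (m + 1) x).
    + apply smooth_n_mult; [apply smooth_n_const|apply IH].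
    + apply functional_extensionality. intros; ring.
Qed.

Definition step (x : R) : R := flat 0 x * / (flat 0 x + flat 0 (1 - x)).

Lemma step_den x : 0 < flat 0 x + flat 0 (1 - x).
Proof.
  destruct (Rle_dec x 0).
  - generalize (flat_ge0 0 x) (flat_gt0 0 (1 - x) ltac:(lra)). lra.
  - generalize (flat_gt0 0 x ltac:(lra)) (flat_ge0 0 (1 - x)). lra.
Qed.

Lemma step_le0 x : x <= 0 -> step x = 0.
Proof. intros H. unfold step. rewrite flat_neg by auto. ring. Qed.

Lemma step_ge1 x : 1 <= x -> step x = 1.
Proof.
  intros H. generalize (step_den x). unfold step. rewrite (flat_neg 0 (1 - x)) by lra.
  intros P. field. lra.
Qed.

Lemma step_bounds x : 0 <= step x <= 1.
Proof.
  generalize (step_den x) (flat_ge0 0 x) (flat_ge0 0 (1 - x)). intros P A B. unfold step.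
  split.
  - apply Rmult_le_pos; auto. left; apply Rinv_0_lt_compat, P.
  - apply (Rmult_le_reg_r (flat 0 x + flat 0 (1 - x))); auto.
    rewrite Rmult_assoc, Rinv_l; lra.
Qed.

Lemma step_gt0 x : 0 < x -> 0 < step x.
Proof.
  intros H. apply Rmult_lt_0_compat; [apply flat_gt0; auto|].
  apply Rinv_0_lt_compat, step_den.
Qed.

Lemma smooth_step : smooth step.
Proof.
  apply smooth_mult; [apply smooth_flat|].
  apply (smooth_inv (fun x => flat 0 x + flat 0 (1 - x))).
  { intros x. generalize (step_den x). lra. }
  apply smooth_plus; [apply smooth_flat|].
  apply (smooth_ext (fun x => flat 0 (-1 * x + 1))); [intros; f_equal; ring|].
  apply smooth_affine, smooth_flat.
Qed.

(** As [flat 0] has derivative [flat 2], the quotient rule leaves a numerator made of products of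
    nonnegative functions. *)
Lemma Derive_step_ge0 x : 0 <= Derive step x.
Proof.
  assert (D : is_derive step x
    ((flat 2 x * flat 0 (1 - x) + flat 0 x * flat 2 (1 - x)) / (flat 0 x + flat 0 (1 - x)) ^ 2)).
  { assert (D1 := is_derive_flat 0 x). assert (D2 := is_derive_flat 0 (1 - x)).
    simpl in D1, D2. rewrite !Rmult_0_l, !Rminus_0_r in D1, D2.
    assert (P := step_den x).
    unfold step. auto_derive.
    - change (1 + - x) with (1 - x).
      split; [eexists; apply D1|]. split; [eexists; apply D1|].
      split; [eexists; apply D2|]. split; auto. lra.
    - change (1 + - x) with (1 - x).
      assert (E1 : Derive (fun t : R => flat 0 t) x = flat 2 x)
        by apply is_derive_unique, D1.
      assert (E2 : Derive (fun t : R => flat 0 t) (1 - x) = flat 2 (1 - x))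
        by apply is_derive_unique, D2.
      rewrite E1, E2.
      field. lra. }
  rewrite (is_derive_unique _ _ _ D).
  assert (P := step_den x).
  generalize (flat_ge0 0 x) (flat_ge0 0 (1 - x)) (flat_ge0 2 x) (flat_ge0 2 (1 - x)). intros.
  apply Rmult_le_pos; [nra|]. left. apply Rinv_0_lt_compat, pow_lt, P.
Qed.

Lemma Derive_locally_const f c a b x : a < x < b -> (forall y, a < y < b -> f y = c) ->
  Derive f x = 0.
Proof.
  intros Hx H. rewrite (Derive_ext_loc f (fun _ => c)); [apply Derive_const|].
  assert (He : 0 < Rmin (x - a) (b - x)) by (apply Rmin_pos; lra).
  exists (mkposreal _ He). intros y Hy. apply Rabs_def2 in Hy. simpl in Hy.
  change (minus y x) with (y - x) in Hy. apply H.
  generalize (Rmin_l (x - a) (b - x)) (Rmin_r (x - a) (b - x)). lra.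
Qed.

Lemma Derive_step_out x : x < 0 \/ 1 < x -> Derive step x = 0.
Proof.
  intros [H|H].
  - apply (Derive_locally_const _ 0 (x - 1) 0); [lra|]. intros; apply step_le0; lra.
  - apply (Derive_locally_const _ 1 1 (x + 1)); [lra|]. intros; apply step_ge1; lra.
Qed.

(** * Circle maps supported in an arc *)

Definition per (F0 : R -> R) (x : R) : R := F0 (frac_part x) + IZR (Int_part x).

Lemma per_eq F0 (k : Z) x : 0 <= x - IZR k < 1 -> per F0 x = F0 (x - IZR k) + IZR k.
Proof.
  intros H. destruct (Int_part_frac_part_spec x k (x - IZR k) H) as (E1 & E2); [ring|].
  unfold per. rewrite <- E1, <- E2. reflexivity.
Qed.

(* What makes [per F0] as regular at the integers as [F0] is. *)
Definition seam (F0 : R -> R) : Prop :=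
  exists rho, 0 < rho <= 1 /\ forall x, - rho < x < 0 -> F0 (x + 1) = F0 x + 1.

(** Just left of an integer [per] uses the formula of the previous period; [seam] says that both
    formulas agree there. *)
Lemma per_locally F0 (k : Z) b x : seam F0 -> 0 <= x + b - IZR k < 1 ->
  locally x (fun y => F0 (y + (b - IZR k)) + (IZR k - b) = per F0 (y + b) - b).
Proof.
  intros (rho & Hr & H) Hx.
  assert (Hd : 0 < Rmin rho (1 - (x + b - IZR k))) by (apply Rmin_pos; lra).
  exists (mkposreal _ Hd). intros y Hy. apply Rabs_def2 in Hy. simpl in Hy.
  change (minus y x) with (y - x) in Hy. revert Hy. Rmin_bounds. rename H0 into M1, H1 into M2.
  destruct (Rle_dec 0 (y + b - IZR k)) as [L|L].
  - rewrite (per_eq F0 k (y + b)) by lra.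
    replace (y + (b - IZR k)) with (y + b - IZR k) by ring. ring.
  - rewrite (per_eq F0 (k - 1) (y + b)) by (rewrite minus_IZR; lra). rewrite minus_IZR.
    replace (y + b - (IZR k - 1)) with (y + (b - IZR k) + 1) by ring.
    rewrite H by lra. ring.
Qed.

Lemma per_Derive F0 (k : Z) b x : smooth F0 -> seam F0 -> 0 <= x + b - IZR k < 1 ->
  Derive (fun y => per F0 (y + b) - b) x = Derive F0 (x + b - IZR k).
Proof.
  intros HS HF Hx.
  apply eq_trans with (1 := eq_sym (Derive_ext_loc _ _ x (per_locally F0 k b x HF Hx))).
  apply is_derive_unique.
  replace (x + b - IZR k) with (x + (b - IZR k)) by ring.
  assert (D : is_derive F0 (x + (b - IZR k)) (Derive F0 (x + (b - IZR k)))).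
  { apply Derive_correct, smooth_ex_derive, HS. }
  replace (Derive F0 (x + (b - IZR k))) with (1 * Derive F0 (x + (b - IZR k)) + 0) by ring.
  apply (is_derive_plus (fun y => F0 (y + (b - IZR k))) (fun _ => IZR k - b));
    [|apply (is_derive_const (IZR k - b))].
  apply (is_derive_comp F0 (fun y => y + (b - IZR k))); auto.
  auto_derive; auto.
Qed.

Lemma per_lift_diff r F0 b : smooth F0 -> seam F0 ->
  (forall x, 0 <= x < 1 -> 0 < Derive F0 x) ->
  lift_diff r (fun x => per F0 (x + b) - b).
Proof.
  intros HS HF HD. split; [|split].
  - apply Cr_local. intros x. destruct (exists_floor (x + b)) as (k & Hk).
    exists (fun y => F0 (1 * y + (b - IZR k)) + (IZR k - b)). split.
    + apply smooth_plus; [apply smooth_affine, HS|apply smooth_const].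
    + generalize (per_locally F0 k b x HF Hk). apply filter_imp. intros y.
      rewrite Rmult_1_l. auto.
  - intros x. destruct (exists_floor (x + b)) as (k & Hk).
    rewrite (per_eq F0 k (x + b)) by auto.
    rewrite (per_eq F0 (k + 1) (x + 1 + b)) by (rewrite plus_IZR; lra). rewrite plus_IZR.
    replace (x + 1 + b - (IZR k + 1)) with (x + b - IZR k) by ring. ring.
  - intros x. destruct (exists_floor (x + b)) as (k & Hk).
    rewrite (per_Derive F0 k) by auto. auto.
Qed.

(** * Interval maps with a prescribed interior fixed point *)

Definition plateau (u : R) : R := step (4 * u) * step (-4 * u + 4).

Lemma smooth_plateau : smooth plateau.
Proof.
  apply smooth_mult; [|apply smooth_affine, smooth_step].
  apply (smooth_ext (fun u => step (4 * u + 0))); [intros; f_equal; ring|].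
  apply smooth_affine, smooth_step.
Qed.

Lemma plateau_out u : u <= 0 \/ 1 <= u -> plateau u = 0.
Proof.
  intros [H|H]; unfold plateau.
  - rewrite step_le0 by lra; ring.
  - rewrite (step_le0 (-4 * u + 4)) by lra; ring.
Qed.

Lemma plateau_in u : 1 / 4 <= u <= 3 / 4 -> plateau u = 1.
Proof. intros H. unfold plateau. rewrite !step_ge1 by lra. ring. Qed.

Lemma plateau_gt0 u : 0 < u < 1 -> 0 < plateau u.
Proof. intros H. apply Rmult_lt_0_compat; apply step_gt0; lra. Qed.

Lemma plateau_bounds u : 0 <= plateau u <= 1.
Proof.
  unfold plateau. generalize (step_bounds (4 * u)) (step_bounds (-4 * u + 4)). intros. nra.
Qed.

(** [plateau] increases only left of 1/4 and decreases only right of 3/4, with [kap] in between. For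
    [del] in (-1, 0] this sign alone makes [bump] increasing. *)
Lemma Derive_plateau_sign kap u : 1 / 4 <= kap <= 3 / 4 -> Derive plateau u * (u - kap) <= 0.
Proof.
  intros Hk.
  assert (D : is_derive plateau u (4 * Derive step (4 * u) * step (-4 * u + 4)
     + step (4 * u) * (-4 * Derive step (-4 * u + 4)))).
  { apply (is_derive_mult (fun u => step (4 * u)) (fun u => step (-4 * u + 4)));
      [| |intros; apply Rmult_comm].
    - apply (is_derive_comp step (fun u => 4 * u)).
      + apply Derive_correct, smooth_ex_derive, smooth_step.
      + auto_derive; auto; ring.
    - apply (is_derive_comp step (fun u => -4 * u + 4)).
      + apply Derive_correct, smooth_ex_derive, smooth_step.
      + auto_derive; auto; ring. }
  rewrite (is_derive_unique _ _ _ D).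
  assert (A : Derive step (4 * u) * (u - kap) <= 0).
  { destruct (Rle_dec u (1 / 4)); [|rewrite Derive_step_out by lra; lra].
    generalize (Derive_step_ge0 (4 * u)). nra. }
  assert (B : 0 <= Derive step (-4 * u + 4) * (u - kap)).
  { destruct (Rle_dec (3 / 4) u); [|rewrite Derive_step_out by lra; lra].
    generalize (Derive_step_ge0 (-4 * u + 4)). nra. }
  generalize (step_bounds (4 * u)) (step_bounds (-4 * u + 4)). intros. nra.
Qed.

(** An interior fixed point [kap] with slope 1 + del: attracting for negative [del], repelling for
    positive [del]. *)
Definition bump (kap del u : R) : R := u + del * (plateau u * (u - kap)).

Lemma smooth_bump kap del : smooth (bump kap del).
Proof.
  apply smooth_plus; [apply smooth_id|]. apply smooth_mult; [apply smooth_const|].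
  apply smooth_mult; [apply smooth_plateau|]. apply smooth_plus; [apply smooth_id|apply smooth_const].
Qed.

Lemma Derive_bump kap del u :
  Derive (bump kap del) u = 1 + del * (Derive plateau u * (u - kap) + plateau u).
Proof.
  apply is_derive_unique. unfold bump.
  apply (is_derive_plus (fun u : R => u) (fun u => del * (plateau u * (u - kap)))); [apply (is_derive_id u)|].
  apply (is_derive_scal (fun u => plateau u * (u - kap))).
  rewrite <- (Rmult_1_r (plateau u)).
  apply (is_derive_mult plateau (fun u => u - kap)); [| |intros; apply Rmult_comm].
  - apply Derive_correct, smooth_ex_derive, smooth_plateau.
  - auto_derive; auto; ring.
Qed.

Lemma Derive_bump_in kap del u : 1 / 4 < u < 3 / 4 -> Derive (bump kap del) u = 1 + del.
Proof.
  intros H. rewrite Derive_bump, plateau_in by lra.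
  rewrite (Derive_locally_const plateau 1 (1 / 4) (3 / 4)); [ring|lra|].
  intros; apply plateau_in; lra.
Qed.

Definition bump_ok (kap del : R) : Prop :=
  1 / 4 <= kap <= 3 / 4 /\ forall u, 0 < Derive (bump kap del) u.

Lemma bump_ok_neg kap del : 1 / 4 <= kap <= 3 / 4 -> -1 < del <= 0 -> bump_ok kap del.
Proof.
  intros Hk Hd. split; auto. intros u. rewrite Derive_bump.
  generalize (Derive_plateau_sign kap u Hk) (plateau_bounds u). intros. nra.
Qed.

(** For positive [del] the flanks push the derivative down, by at most [del] times the maximum of
    [D], which compactness provides. This is why the repelling rate is not explicit. *)
Lemma bump_ok_pos kap : 1 / 4 <= kap <= 3 / 4 -> exists del, 0 < del <= 1 /\ bump_ok kap del.
Proof.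
  intros Hk. set (D := fun u => - (Derive plateau u * (u - kap))).
  assert (C : continuity D).
  { intros u. apply continuity_pt_filterlim.
    apply (continuous_opp (fun u => Derive plateau u * (u - kap))).
    apply (continuous_mult (Derive plateau) (fun u => u - kap)).
    - apply (smooth_Derive_n plateau 1 smooth_plateau 0%nat).
    - apply (ex_derive_continuous (fun u => u - kap)). auto_derive; auto. }
  destruct (continuity_ab_maj D 0 1) as (c & Hc & _); [lra|intros; apply C|].
  assert (P : 0 <= D c) by (unfold D; generalize (Derive_plateau_sign kap c Hk); lra).
  assert (B : forall u, D u <= D c).
  { intros u. destruct (Rlt_dec u 0) as [H|H]; [|destruct (Rlt_dec 1 u) as [H'|H'];
      [|apply Hc; lra]]; unfold D at 1.
    - rewrite (Derive_locally_const plateau 0 (u - 1) 0); [lra|lra|].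
      intros; apply plateau_out; lra.
    - rewrite (Derive_locally_const plateau 0 1 (u + 1)); [lra|lra|].
      intros; apply plateau_out; lra. }
  exists (/ (1 + D c)).
  assert (I : 0 < / (1 + D c)) by (apply Rinv_0_lt_compat; lra).
  assert (E : / (1 + D c) * (1 + D c) = 1) by (field; lra).
  split; [nra|]. split; auto. intros u. rewrite Derive_bump.
  specialize (B u). unfold D at 1 in B. generalize (plateau_bounds u).
  set (i := / (1 + D c)) in *. intros. nra.
Qed.

Lemma bump_out kap del u : u <= 0 \/ 1 <= u -> bump kap del u = u.
Proof. intros H. unfold bump. rewrite plateau_out by auto. ring. Qed.

Lemma bump_in kap del u : 1 / 4 <= u <= 3 / 4 -> bump kap del u = kap + (1 + del) * (u - kap).
Proof. intros H. unfold bump. rewrite plateau_in by auto. ring. Qed.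

(* [arc_base] puts the bump in the middle of [0,1], away from the seam of [per];
   [arc_map] moves it to the arc (a, a+w). *)
Definition arc_base (w kap del x : R) : R :=
  (1 - w) / 2 + w * bump kap del (/ w * x + - ((1 - w) / 2 / w)).

Definition arc_map (a w kap del x : R) : R :=
  per (arc_base w kap del) (x + ((1 - w) / 2 - a)) - ((1 - w) / 2 - a).

Lemma arc_coord w x : 0 < w -> / w * x + - ((1 - w) / 2 / w) = (x - (1 - w) / 2) / w.
Proof. intros; field; lra. Qed.

Lemma arc_base_out w kap del x : 0 < w -> x <= (1 - w) / 2 \/ (1 - w) / 2 + w <= x ->
  arc_base w kap del x = x.
Proof.
  intros Hw H. unfold arc_base. rewrite arc_coord by auto.
  assert (E : w * ((x - (1 - w) / 2) / w) = x - (1 - w) / 2) by (field; lra).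
  set (u := (x - (1 - w) / 2) / w) in *.
  rewrite bump_out; [lra|]. destruct H; [left|right]; nra.
Qed.

Lemma smooth_arc_base w kap del : smooth (arc_base w kap del).
Proof.
  apply smooth_plus; [apply smooth_const|]. apply smooth_mult; [apply smooth_const|].
  apply smooth_affine, smooth_bump.
Qed.

Lemma seam_arc_base w kap del : 0 < w < 1 -> seam (arc_base w kap del).
Proof.
  intros Hw. exists ((1 - w) / 2). split; [lra|]. intros x Hx.
  rewrite !arc_base_out by lra. ring.
Qed.

Lemma Derive_arc_base w kap del x : 0 < w ->
  Derive (arc_base w kap del) x = Derive (bump kap del) ((x - (1 - w) / 2) / w).
Proof.
  intros Hw. apply is_derive_unique. rewrite <- arc_coord by auto. unfold arc_base.
  set (v := / w * x + - ((1 - w) / 2 / w)).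
  replace (Derive (bump kap del) v) with (0 + w * (/ w * Derive (bump kap del) v)) by (field; lra).
  apply (is_derive_plus (fun _ => (1 - w) / 2)); [apply (is_derive_const ((1 - w) / 2))|].
  apply (is_derive_scal (fun x => bump kap del (/ w * x + - ((1 - w) / 2 / w)))).
  apply (is_derive_comp (bump kap del) (fun x => / w * x + - ((1 - w) / 2 / w))).
  - apply Derive_correct, smooth_ex_derive, smooth_bump.
  - auto_derive; auto; ring.
Qed.

Lemma arc_map_lift_diff r a w kap del : 0 < w < 1 -> bump_ok kap del ->
  lift_diff r (arc_map a w kap del).
Proof.
  intros Hw (_ & Hb). apply per_lift_diff.
  - apply smooth_arc_base.
  - apply seam_arc_base, Hw.
  - intros x _. rewrite Derive_arc_base by lra. apply Hb.
Qed.

Lemma arc_map_C1lift a w kap del : 0 < w < 1 -> bump_ok kap del -> C1lift (arc_map a w kap del).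
Proof.
  intros Hw Hb. apply (lift_diff_C1lift Inf); [exact I|apply arc_map_lift_diff; auto].
Qed.

Lemma arc_map_in a w kap del u : 0 < w < 1 -> 0 <= u <= 1 ->
  arc_map a w kap del (a + w * u) = a + w * bump kap del u.
Proof.
  intros Hw Hu. unfold arc_map. rewrite (per_eq _ 0) by nra.
  unfold arc_base. rewrite arc_coord by lra.
  replace ((a + w * u + ((1 - w) / 2 - a) - 0 - (1 - w) / 2) / w) with u by (field; lra).
  ring.
Qed.

Lemma arc_map_Derive a w kap del u : 0 < w < 1 -> 1 / 4 < u < 3 / 4 ->
  Derive (arc_map a w kap del) (a + w * u) = 1 + del.
Proof.
  intros Hw Hu. unfold arc_map.
  rewrite (per_Derive _ 0); [|apply smooth_arc_base|apply seam_arc_base; auto|nra].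
  rewrite Derive_arc_base by lra.
  replace ((a + w * u + ((1 - w) / 2 - a) - 0 - (1 - w) / 2) / w) with u by (field; lra).
  apply Derive_bump_in, Hu.
Qed.

Lemma arc_map_out a w kap del x : 0 < w < 1 ->
  (forall k : Z, ~ (a < x - IZR k < a + w)) -> arc_map a w kap del x = x.
Proof.
  intros Hw H. unfold arc_map.
  destruct (exists_floor (x + ((1 - w) / 2 - a))) as (k & Hk). specialize (H k).
  rewrite (per_eq _ k) by auto. rewrite arc_base_out; [ring|lra|lra].
Qed.

(** * Orbits inside the supporting arc *)

Lemma arc_point a w x : 0 < w -> exists u, x = a + w * u.
Proof. intros Hw. exists ((x - a) / w). field. lra. Qed.

(** Below [b'] every step advances by at least the positive minimum of f y - y on [x, b'], so the
    orbit gets past [b']; monotonicity keeps it below the fixed point [c]. *)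
Lemma orbit_up f a b c x : continuity f -> (forall y z, y < z -> f y < f z) -> f c = c ->
  (forall y, a < y < c -> y < f y) -> a < x < c -> b < c ->
  exists n, b < Nat.iter (S n) f x < c.
Proof.
  intros Hc Hm Hfc Hup Hx Hb.
  set (b' := Rmax b x).
  assert (Hb' : b <= b' /\ x <= b' < c).
  { unfold b'. generalize (Rmax_l b x) (Rmax_r b x). unfold Rmax. destruct Rle_dec; lra. }
  clearbody b'.
  destruct (continuity_ab_min (fun y => f y - y) x b') as (m & Hm1 & Hm2); [lra| |].
  { intros y _. apply continuity_pt_minus; [apply Hc|apply derivable_continuous_pt, derivable_pt_id]. }
  set (d := f m - m) in *.
  assert (Hd : 0 < d) by (unfold d; generalize (Hup m); lra).
  clearbody d.
  assert (P : forall n, (exists n, b < Nat.iter (S n) f x < c) \/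
     x + INR n * d <= Nat.iter n f x <= b').
  { induction n as [|n [IH|IH]]; [right; simpl; lra|left; auto|].
    rewrite S_INR. assert (0 <= INR n * d) by (apply Rmult_le_pos; [apply pos_INR|lra]).
    set (y := Nat.iter n f x) in *.
    assert (d <= f y - y) by (apply Hm1; lra).
    assert (f y < c) by (rewrite <- Hfc; apply Hm; lra).
    destruct (Rlt_dec b' (f y)).
    - left. exists n. simpl. fold y. lra.
    - right. simpl. fold y. lra. }
  destruct (INR_unbounded ((b' - x) / d)) as (N & HN).
  destruct (P N) as [H|H]; auto.
  apply (Rmult_lt_compat_r d) in HN; auto.
  replace ((b' - x) / d * d) with (b' - x) in HN by (field; lra). lra.
Qed.

(** The reflection y -> -y reduces this to [orbit_up]. *)
Lemma orbit_down f a b c x : continuity f -> (forall y z, y < z -> f y < f z) -> f a = a ->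
  (forall y, a < y < c -> f y < y) -> a < x < c -> a < b ->
  exists n, a < Nat.iter (S n) f x < b.
Proof.
  intros Hc Hm Hfa Hdn Hx Hb.
  assert (E : forall n, Nat.iter n (fun y => - f (- y)) (- x) = - Nat.iter n f x).
  { induction n as [|n IH]; simpl; auto. rewrite IH, Ropp_involutive. reflexivity. }
  destruct (orbit_up (fun y => - f (- y)) (- c) (- b) (- a) (- x)) as (n & Hn).
  - intros y. apply continuity_pt_opp.
    apply (continuity_pt_comp (fun y => - y) f); [|apply Hc].
    apply continuity_pt_opp, derivable_continuous_pt, derivable_pt_id.
  - intros y z H. generalize (Hm (- z) (- y)). lra.
  - rewrite Ropp_involutive, Hfa. reflexivity.
  - intros y Hy. generalize (Hdn (- y)). lra.
  - lra.
  - lra.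
  - exists n. rewrite E in Hn. lra.
Qed.

Lemma arc_map_up a w kap del x : 0 < w < 1 -> 0 < del * (x - (a + w * kap)) ->
  a < x < a + w -> x < arc_map a w kap del x.
Proof.
  intros Hw Hd Hx. destruct (arc_point a w x) as (u & ->); [lra|].
  assert (Hu : 0 < u < 1) by (split; nra).
  rewrite arc_map_in by lra. unfold bump. generalize (plateau_gt0 u Hu). intros P.
  assert (0 < del * (u - kap)) by nra.
  assert (0 < plateau u * (del * (u - kap))) by (apply Rmult_lt_0_compat; auto). nra.
Qed.

Lemma arc_map_down a w kap del x : 0 < w < 1 -> del * (x - (a + w * kap)) < 0 ->
  a < x < a + w -> arc_map a w kap del x < x.
Proof.
  intros Hw Hd Hx. destruct (arc_point a w x) as (u & ->); [lra|].
  assert (Hu : 0 < u < 1) by (split; nra).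
  rewrite arc_map_in by lra. unfold bump. generalize (plateau_gt0 u Hu). intros P.
  assert (del * (u - kap) < 0) by nra.
  assert (0 < plateau u * - (del * (u - kap))) by (apply Rmult_lt_0_compat; lra). nra.
Qed.

Lemma arc_map_center a w kap del : 0 < w < 1 -> 1 / 4 <= kap <= 3 / 4 ->
  arc_map a w kap del (a + w * kap) = a + w * kap.
Proof. intros Hw Hk. rewrite arc_map_in, bump_in by lra. ring. Qed.

Lemma arc_map_left a w kap del : 0 < w < 1 -> arc_map a w kap del a = a.
Proof.
  intros Hw. replace a with (a + w * 0) at 2 by ring. rewrite arc_map_in, bump_out by lra. ring.
Qed.

Lemma arc_map_right a w kap del : 0 < w < 1 -> arc_map a w kap del (a + w) = a + w.
Proof.
  intros Hw. replace (a + w) with (a + w * 1) at 1 by ring. rewrite arc_map_in, bump_out by lra. ring.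
Qed.

(** In the coordinate of the arc, the fixed point 2/5 attracts the whole open arc and lies inside
    the target (3/10, 7/10). *)
Lemma arc_forward a w Gs x : 0 < w < 1 -> In (arc_map a w (2 / 5) (-1 / 4)) Gs ->
  a < x < a + w -> fgood Gs (a + w * (3 / 10)) (a + w * (7 / 10)) x.
Proof.
  intros Hw HG Hx.
  assert (L : C1lift (arc_map a w (2 / 5) (-1 / 4))).
  { apply arc_map_C1lift; auto. apply bump_ok_neg; lra. }
  set (c := a + w * (2 / 5)).
  assert (Hc : arc_map a w (2 / 5) (-1 / 4) c = c) by (apply arc_map_center; lra).
  destruct (Rtotal_order x c) as [H|[H|H]].
  - destruct (orbit_up (arc_map a w (2 / 5) (-1 / 4)) a (a + w * (3 / 10)) c x) as (n & Hn);
      auto; try (unfold c in *; try split; nra).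
    + apply C1lift_continuity; auto.
    + intros; apply C1lift_lt; auto.
    + intros y Hy. apply arc_map_up; auto; [fold c; lra|unfold c in *; nra].
    + eexists _, 0%Z. split; [apply (in_sg_iter _ _ n HG)|]. cbv beta. unfold c in *. nra.
  - exists (arc_map a w (2 / 5) (-1 / 4)), 0%Z. split; [apply sg_gen; auto|].
    rewrite H, Hc. unfold c. nra.
  - destruct (orbit_down (arc_map a w (2 / 5) (-1 / 4)) c (a + w * (7 / 10)) (a + w) x)
      as (n & Hn); auto; try (unfold c in *; try split; nra).
    + apply C1lift_continuity; auto.
    + intros; apply C1lift_lt; auto.
    + intros y Hy. apply arc_map_down; auto; [fold c; lra|unfold c in *; nra].
    + eexists _, 0%Z. split; [apply (in_sg_iter _ _ n HG)|]. cbv beta. unfold c in *. nra.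
Qed.

(** The core contains the repelling fixed point 1/2. Iterates of 23/50 and 27/50, which are core
    points on its two sides, tend to the ends of the arc and so enclose [y] together with the fixed
    point. *)
Lemma arc_backward a w del Gs y : 0 < w < 1 -> 0 < del -> bump_ok (1 / 2) del ->
  In (arc_map a w (1 / 2) del) Gs ->
  a < y < a + w -> bgood Gs (a + w * (9 / 20)) (a + w * (11 / 20)) y.
Proof.
  intros Hw Hd Hok HG Hy.
  assert (L : C1lift (arc_map a w (1 / 2) del)) by (apply arc_map_C1lift; auto).
  assert (LI : forall n, C1lift (fun x => Nat.iter (S n) (arc_map a w (1 / 2) del) x)).
  { intros n. apply (in_sg_C1lift (arc_map a w (1 / 2) del :: nil)); [auto|].
    apply in_sg_iter. left; auto. }
  set (c := a + w * (1 / 2)).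
  assert (Hc : arc_map a w (1 / 2) del c = c) by (apply arc_map_center; lra).
  assert (HI : forall n, Nat.iter n (arc_map a w (1 / 2) del) c = c).
  { induction n as [|n IH]; simpl; [|rewrite IH]; auto. }
  destruct (Rtotal_order y c) as [H|[H|H]].
  - destruct (orbit_down (arc_map a w (1 / 2) del) a y c (a + w * (23 / 50))) as (n & Hn);
      auto; try (unfold c in *; try split; nra).
    + apply C1lift_continuity; auto.
    + intros; apply C1lift_lt; auto.
    + apply arc_map_left, Hw.
    + intros z Hz. apply arc_map_down; auto; [fold c; nra|unfold c in *; nra].
    + destruct (C1lift_IVT_lt _ (LI n) (a + w * (23 / 50)) c y) as (z & Hz & Ez).
      * unfold c; nra.
      * rewrite HI. lra.
      * eexists _, z, 0%Z. split; [apply (in_sg_iter _ _ n HG)|].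
        split; [unfold c in *; nra|]. cbv beta in *. lra.
  - exists (arc_map a w (1 / 2) del), c, 0%Z. split; [apply sg_gen; auto|].
    split; [unfold c; nra|]. lra.
  - destruct (orbit_up (arc_map a w (1 / 2) del) c y (a + w) (a + w * (27 / 50))) as (n & Hn);
      auto; try (unfold c in *; try split; nra).
    + apply C1lift_continuity; auto.
    + intros; apply C1lift_lt; auto.
    + apply arc_map_right, Hw.
    + intros z Hz. apply arc_map_up; auto; [fold c; nra|unfold c in *; nra].
    + destruct (C1lift_IVT_lt _ (LI n) c (a + w * (27 / 50)) y) as (z & Hz & Ez).
      * unfold c; nra.
      * rewrite HI. lra.
      * eexists _, z, 0%Z. split; [apply (in_sg_iter _ _ n HG)|].
        split; [unfold c in *; nra|]. cbv beta in *. lra.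
Qed.

(** With slope 3/4 the core [9/20, 11/20] goes to [7/16, 41/80] for [kap] = 2/5 and to [39/80, 9/16]
    for [kap] = 3/5. Shrunk by 1/80 at each end these become [9/20, 1/2] and [1/2, 11/20], which
    meet at 1/2; 7/8 leaves room above the slope. *)
Lemma arc_branch a w kap u v : 0 < w < 1 -> 2 / 5 <= kap <= 3 / 5 ->
  u = kap / 4 + 3 / 4 * (9 / 20) + 1 / 80 -> v = kap / 4 + 3 / 4 * (11 / 20) - 1 / 80 ->
  branch (w / 80) (7 / 8) (a + w * (3 / 10)) (a + w * (7 / 10))
    (a + w * (9 / 20)) (a + w * (11 / 20)) (a + w * u) (a + w * v)
    (arc_map a w kap (-1 / 4)) 0.
Proof.
  intros Hw Hk Hu Hv. split; [|split].
  - intros x Hx. destruct (arc_point a w x) as (t & ->); [lra|].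
    assert (Ht : 3 / 10 <= t <= 7 / 10) by (split; nra).
    rewrite arc_map_in, bump_in, arc_map_Derive by lra. split; nra.
  - rewrite arc_map_in, bump_in by lra. subst u; nra.
  - rewrite arc_map_in, bump_in by lra. subst v; nra.
Qed.

Lemma arc_blender a w Gs : 0 < w < 1 ->
  In (arc_map a w (2 / 5) (-1 / 4)) Gs -> In (arc_map a w (3 / 5) (-1 / 4)) Gs ->
  blender (w / 80) (7 / 8) (a + w * (3 / 10)) (a + w * (7 / 10))
    (a + w * (9 / 20)) (a + w * (11 / 20)) Gs.
Proof.
  intros Hw H1 H2. split; [nra|]. split; [nra|]. split; [lra|].
  exists (arc_map a w (2 / 5) (-1 / 4)), (arc_map a w (3 / 5) (-1 / 4)), 0%Z, 0%Z, (a + w * (1 / 2)).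
  split; auto. split; auto. split; apply arc_branch; lra.
Qed.

Lemma affine_lift_diff r b : lift_diff r (fun x => x + b).
Proof.
  split; [|split].
  - apply Cr_local. intros x. exists (fun x => x + b). split.
    + apply smooth_plus; [apply smooth_id|apply smooth_const].
    + exists (mkposreal 1 Rlt_0_1). auto.
  - intros; ring.
  - intros x. replace (Derive (fun x => x + b) x) with 1; [lra|].
    symmetry. apply is_derive_unique. auto_derive; auto.
Qed.

Lemma not_minimal_of_invariant Fs (K V : R -> Prop) x0 :
  (forall f, In f Fs -> forall x, K x -> K (f x)) -> K x0 ->
  circ_open V -> (exists y, V y) -> (forall x, V x -> ~ K x) -> ~ minimal Fs.
Proof.
  intros HK H0 HV NV D HM. destruct (HM x0 V HV NV) as (h & Hh & Vh).
  apply (D _ Vh). clear Vh. revert x0 H0.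
  induction Hh as [f Hf|f h Hf Hh IH]; intros x0 H0; auto.
Qed.

Lemma inverse_family_In Fs Gs g : inverse_family Fs Gs -> In g Gs ->
  exists f, In f Fs /\ forall x, f (g x) = x /\ g (f x) = x.
Proof.
  intros H. induction H as [|f g' Fs Gs E H IH]; intros Hg; [destruct Hg|].
  destruct Hg as [<-|Hg].
  - exists f; split; auto. left; auto.
  - destruct (IH Hg) as (f' & Hf' & E'). exists f'; split; auto. right; auto.
Qed.

Lemma inverse_family_exists Fs : List.Forall C1lift Fs -> exists Gs, inverse_family Fs Gs.
Proof.
  intros H. induction H as [|f Fs Hf H (Gs & IH)].
  - exists nil. constructor.
  - destruct (C1lift_inverse f Hf) as (g & Hg). exists (g :: Gs). constructor; auto.
Qed.

Definition arcs (a b x : R) : Prop := exists k : Z, a < x - IZR k < b.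

Lemma arcs_open a b : circ_open (arcs a b).
Proof.
  split.
  - intros x; split; intros (k & Hk); [exists (k + 1)%Z|exists (k - 1)%Z];
      rewrite ?plus_IZR, ?minus_IZR; lra.
  - intros x (k & Hk). exists (Rmin (x - IZR k - a) (b - (x - IZR k))).
    split; [apply Rmin_pos; lra|]. intros y Hy. exists k. apply Rabs_def2 in Hy.
    generalize (Rmin_l (x - IZR k - a) (b - (x - IZR k)))
      (Rmin_r (x - IZR k - a) (b - (x - IZR k))). lra.
Qed.

Lemma fgood_pull Gs j0 j1 h x : in_sg Gs h -> fgood Gs j0 j1 (h x) -> fgood Gs j0 j1 x.
Proof.
  intros Hh (h' & k & Hh' & H). exists (fun x => h' (h x)), k. split; auto.
  apply in_sg_comp; auto.
Qed.

Lemma bgood_push Gs i0 i1 h y : C1lift h -> in_sg Gs h ->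
  bgood Gs i0 i1 y -> bgood Gs i0 i1 (h y).
Proof.
  intros Lh Hh (h' & z & k & Hh' & Hz & H). exists (fun x => h (h' x)), z, k.
  split; [apply in_sg_comp; auto|]. split; auto. rewrite H. apply C1lift_Z; auto.
Qed.

(** * A family with a common fixed point *)

Lemma arc_map_fix a w kap del : 0 < w < 1 -> (forall k : Z, ~ (a < - IZR k < a + w)) ->
  forall k : Z, arc_map a w kap del (IZR k) = IZR k.
Proof.
  intros Hw H k. apply arc_map_out; auto. intros m. specialize (H (m - k)%Z).
  rewrite minus_IZR in H. lra.
Qed.

Lemma Z_fix1 : forall k : Z, ~ (1 / 10 < - IZR k < 1 / 10 + 4 / 5).
Proof.
  intros k H. rewrite <- opp_IZR in H.
  assert (0 < IZR (- k)) as H1 by lra. assert (IZR (- k) < 1) as H2 by lra.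
  apply lt_IZR in H1, H2. lia.
Qed.

Lemma arc_map_fix_center kap del : kap = 1 / 2 ->
  (exists r, lift_diff r (arc_map (-2 / 5) (4 / 5) kap del)) ->
  forall k : Z, arc_map (-2 / 5) (4 / 5) kap del (IZR k) = IZR k.
Proof.
  intros -> (r & _ & H & _) k.
  replace (IZR k) with (0 + IZR k) by ring. rewrite translate_Z by auto. f_equal.
  replace 0 with (-2 / 5 + 4 / 5 * (1 / 2)) by field. apply arc_map_center; lra.
Qed.

Lemma exists_RT_not_minimal r k : le_reg 1 r -> (8 <= k)%nat ->
  exists Gs, RT r k Gs /\ ~ minimal Gs /\ exists Gi, inverse_family Gs Gi /\ ~ minimal Gi.
Proof.
  intros Hr Hk.
  destruct (bump_ok_pos (1 / 2)) as (del & Hd & Hok); [lra|].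
  assert (Hneg : forall kap, 1 / 4 <= kap <= 3 / 4 -> bump_ok kap (-1 / 4)).
  { intros kap H. apply bump_ok_neg; lra. }
  set (e1 := arc_map (1 / 10) (4 / 5) (2 / 5) (-1 / 4)).
  set (e2 := arc_map (1 / 10) (4 / 5) (3 / 5) (-1 / 4)).
  set (e3 := arc_map (1 / 10) (4 / 5) (1 / 2) del).
  (* The arc (-2/5, 2/5) is centred at the common fixed point 0, which lies outside the arc of [e1],
     [e2], [e3]. Near 0, [q1] expands forwards and [q2] expands backwards. *)
  set (q1 := arc_map (-2 / 5) (4 / 5) (1 / 2) del).
  set (q2 := arc_map (-2 / 5) (4 / 5) (1 / 2) (-1 / 4)).
  (* The identity brings the family to [k] members and respects the common fixed point. *)
  set (Gs := e1 :: e2 :: e3 :: q1 :: q2 :: repeat (fun x => x + 0) (k - 5)).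
  assert (HL : List.Forall (lift_diff r) Gs).
  { unfold Gs, e1, e2, e3, q1, q2.
    do 5 (constructor; [apply arc_map_lift_diff; auto; try apply Hneg; lra|]).
    apply Forall_forall. intros f Hf. apply repeat_spec in Hf. subst f.
    apply affine_lift_diff. }
  assert (HI : IFS r k Gs).
  { split; auto. unfold Gs. simpl. rewrite repeat_length. lia. }
  assert (HC := IFS_C1lift r k Gs Hr HI).
  assert (Q : forall f, In f Gs -> C1lift f) by (apply Forall_forall; auto).
  assert (I1 : In e1 Gs) by (unfold Gs; simpl; auto).
  assert (I2 : In e2 Gs) by (unfold Gs; simpl; auto).
  assert (I3 : In e3 Gs) by (unfold Gs; simpl; auto).
  assert (I4 : In q1 Gs) by (unfold Gs; simpl; auto 6).
  assert (I5 : In q2 Gs) by (unfold Gs; simpl; auto 7).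
  assert (Z0 : forall f, In f Gs -> forall m : Z, f (IZR m) = IZR m).
  { assert (X : exists r, lift_diff r q1) by (exists r; rewrite Forall_forall in HL; auto).
    assert (Y : exists r, lift_diff r q2) by (exists r; rewrite Forall_forall in HL; auto).
    intros f [<-|[<-|[<-|[<-|[<-|Hf]]]]] m.
    - apply arc_map_fix; [lra|apply Z_fix1].
    - apply arc_map_fix; [lra|apply Z_fix1].
    - apply arc_map_fix; [lra|apply Z_fix1].
    - apply arc_map_fix_center; auto.
    - apply arc_map_fix_center; auto.
    - apply repeat_spec in Hf. subst f. ring. }
  set (j0 := 1 / 10 + 4 / 5 * (3 / 10)). set (j1 := 1 / 10 + 4 / 5 * (7 / 10)).
  set (i0 := 1 / 10 + 4 / 5 * (9 / 20)). set (i1 := 1 / 10 + 4 / 5 * (11 / 20)).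
  assert (Fg : forall x, 1 / 10 < x < 9 / 10 -> fgood Gs j0 j1 x).
  { intros x Hx. apply arc_forward; auto; lra. }
  assert (Bg : forall x, 1 / 10 < x < 9 / 10 -> bgood Gs i0 i1 x).
  { intros x Hx. apply (arc_backward _ _ del); auto; lra. }
  assert (Fg' : forall x, -9 / 10 < x < -1 / 10 -> fgood Gs j0 j1 x).
  { intros x Hx. replace x with (x + 1 + IZR (-1)) by (simpl; ring).
    apply fgood_Z; auto. apply Fg; lra. }
  assert (Bg' : forall x, -9 / 10 < x < -1 / 10 -> bgood Gs i0 i1 x).
  { intros x Hx. replace x with (x + 1 + IZR (-1)) by (simpl; ring).
    apply bgood_Z, Bg; lra. }
  assert (Red : forall x, exists m : Z, -1 / 10 <= x - IZR m <= 1 / 10 \/ 1 / 10 < x - IZR m < 9 / 10).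
  { intros x. destruct (exists_floor x) as (m & Hm).
    destruct (Rlt_dec (x - IZR m) (9 / 10)).
    - exists m. lra.
    - exists (m + 1)%Z. rewrite plus_IZR. lra. }
  (* Near 0, [q1] expands by 1 + del and the inverse of [q2] by 4/3. *)
  set (lam := Rmin (1 + del) (4 / 3)).
  assert (Hl : 1 < lam) by (unfold lam; apply Rmin_glb_lt; lra).
  assert (Hl1 : lam <= 1 + del) by apply Rmin_l.
  assert (Hl2 : lam <= 4 / 3) by apply Rmin_r.
  assert (Dq : forall kap d x, -3 / 20 <= x <= 3 / 20 ->
     Derive (arc_map (-2 / 5) (4 / 5) kap d) x = 1 + d).
  { intros kap d x Hx. replace x with (-2 / 5 + 4 / 5 * (5 / 4 * x + 1 / 2)) by field.
    apply arc_map_Derive; lra. }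
  exists Gs. split; [|split].
  - apply (RT_of_blender r k (4 / 5 / 80) (7 / 8) j0 j1 i0 i1 lam); auto; try lra.
    + apply arc_blender; auto; lra.
    + intros y. destruct (Red y) as (m & [Hm|Hm]);
        replace y with (y - IZR m + IZR m) by ring; [right|left; apply bgood_Z, Bg, Hm].
      apply bexp_Z.
      assert (V : forall x, -3 / 20 <= x <= 3 / 20 -> q2 x = 3 / 4 * x).
      { intros x Hx. unfold q2. replace x with (-2 / 5 + 4 / 5 * (5 / 4 * x + 1 / 2)) at 1 by field.
        rewrite arc_map_in, bump_in by lra. field. }
      (* The interval lies in the linear part of [q2], and its image [-9/80, 9/80] ends beyond
         [-1/10, 1/10], hence at points already known to be good. *)
      exists q2, (-3 / 20), (3 / 20), 0%Z. split; [apply sg_gen; auto|].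
      rewrite !V by lra. split; [lra|]. split; [lra|].
      split; [apply Bg'; lra|]. split; [apply Bg; lra|].
      intros z Hz. unfold q2. rewrite Dq by lra. lra.
    + intros x. destruct (Red x) as (m & [Hm|Hm]);
        replace x with (x - IZR m + IZR m) by ring;
        [right|left; apply fgood_Z; auto; apply Fg, Hm].
      apply fexp_Z; auto.
      exists (-3 / 20), (3 / 20), q1. split; [lra|].
      split; [apply Fg'; lra|]. split; [apply Fg; lra|]. split; [apply sg_gen; auto|].
      intros z Hz. unfold q1. rewrite Dq by lra. lra.
  - apply (not_minimal_of_invariant Gs (fun x => exists m : Z, x = IZR m) (arcs 0 1) 0).
    + intros f Hf x (m & ->). exists m. apply Z0; auto.
    + exists 0%Z; auto.
    + apply arcs_open.
    + exists (1 / 2), 0%Z. lra.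
    + intros x (m & Hm) (n & ->). rewrite <- minus_IZR in Hm.
      destruct Hm as (H1 & H2). apply lt_IZR in H1, H2. lia.
  - destruct (inverse_family_exists Gs HC) as (Gi & HGi). exists Gi; split; auto.
    apply (not_minimal_of_invariant Gi (fun x => exists m : Z, x = IZR m) (arcs 0 1) 0).
    + intros g Hg x (m & ->). destruct (inverse_family_In _ _ _ HGi Hg) as (f & Hf & E).
      exists m. rewrite <- (Z0 f Hf m) at 1. apply E.
    + exists 0%Z; auto.
    + apply arcs_open.
    + exists (1 / 2), 0%Z. lra.
    + intros x (m & Hm) (n & ->). rewrite <- minus_IZR in Hm.
      destruct Hm as (H1 & H2). apply lt_IZR in H1, H2. lia.
Qed.

(** * A minimal family preserving the complement of a Cantor set *)

(* Affine of slope 1/3, 9, 1/3 around [0,1/2], [2/3,13/18] and 1; the transitions are placed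
   where the next affine piece dominates the previous one, so that the interpolation increases. *)
Definition cantor_base (x : R) : R :=
  x * / 3 + (step (150 * x + -99) * (26 / 3 * x + -17 / 3)
   + step (900 / 7 * x + -650 / 7) * (-26 / 3 * x + 19 / 3)).

Lemma smooth_cantor_base : smooth cantor_base.
Proof.
  apply smooth_plus; [apply smooth_mult; [apply smooth_id|apply smooth_const]|].
  assert (A : forall a b, smooth (fun x => a * x + b)).
  { intros a b. apply smooth_plus; [|apply smooth_const].
    apply smooth_mult; [apply smooth_const|apply smooth_id]. }
  apply smooth_plus; apply smooth_mult; auto; apply smooth_affine, smooth_step.
Qed.

Lemma cantor_base_left x : x <= 33 / 50 -> cantor_base x = x / 3.
Proof. intros H. unfold cantor_base. rewrite !step_le0 by lra. field. Qed.

Lemma cantor_base_mid x : 2 / 3 <= x <= 13 / 18 -> cantor_base x = 9 * (x - 2 / 3) + 1 / 3.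
Proof.
  intros H. unfold cantor_base. rewrite step_ge1, step_le0 by lra. field.
Qed.

Lemma cantor_base_right x : 73 / 100 <= x -> cantor_base x = x / 3 + 2 / 3.
Proof. intros H. unfold cantor_base. rewrite !step_ge1 by lra. field. Qed.

Lemma Derive_cantor_base x : Derive cantor_base x =
  / 3 + (150 * Derive step (150 * x + -99) * (26 / 3 * x + -17 / 3)
    + step (150 * x + -99) * (26 / 3)
    + (900 / 7 * Derive step (900 / 7 * x + -650 / 7) * (-26 / 3 * x + 19 / 3)
    + step (900 / 7 * x + -650 / 7) * (-26 / 3))).
Proof.
  assert (S : forall a b c d, is_derive (fun x => step (a * x + b) * (c * x + d)) x
     (a * Derive step (a * x + b) * (c * x + d) + step (a * x + b) * c)).
  { intros a b c d.
    apply (is_derive_mult (fun x => step (a * x + b)) (fun x => c * x + d));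
      [| |intros; apply Rmult_comm].
    - apply (is_derive_comp step (fun x => a * x + b)).
      + apply Derive_correct, smooth_ex_derive, smooth_step.
      + auto_derive; auto; ring.
    - auto_derive; auto; ring. }
  apply is_derive_unique. unfold cantor_base.
  apply (is_derive_plus (fun x : R => x * / 3)
    (fun x => step (150 * x + -99) * (26 / 3 * x + -17 / 3)
       + step (900 / 7 * x + -650 / 7) * (-26 / 3 * x + 19 / 3))).
  - auto_derive; auto; ring.
  - apply (is_derive_plus (fun x => step (150 * x + -99) * (26 / 3 * x + -17 / 3))); apply S.
Qed.

(** The affine corrections are nonnegative where their steps vary, because 17/26 < 33/50 and 73/100
    < 19/26. The second step starts after the first has ended, so the slope never drops below
    1/3. *)
Lemma Derive_cantor_base_pos x : 0 < Derive cantor_base x.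
Proof.
  rewrite Derive_cantor_base.
  assert (A : 0 <= Derive step (150 * x + -99) * (26 / 3 * x + -17 / 3)).
  { destruct (Rlt_dec x (33 / 50)); [rewrite Derive_step_out by lra; lra|].
    apply Rmult_le_pos; [apply Derive_step_ge0|lra]. }
  assert (B : 0 <= Derive step (900 / 7 * x + -650 / 7) * (-26 / 3 * x + 19 / 3)).
  { destruct (Rlt_dec (73 / 100) x); [rewrite Derive_step_out by lra; lra|].
    apply Rmult_le_pos; [apply Derive_step_ge0|lra]. }
  assert (C : step (900 / 7 * x + -650 / 7) <= step (150 * x + -99)).
  { destruct (Rle_dec x (13 / 18)).
    - rewrite (step_le0 (900 / 7 * x + -650 / 7)) by lra. apply step_bounds.
    - rewrite (step_ge1 (150 * x + -99)) by lra. apply step_bounds. }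
  lra.
Qed.

Lemma seam_cantor_base : seam cantor_base.
Proof.
  (* The last affine piece begins at 73/100, at distance 27/100 from 1. *)
  exists (27 / 100). split; [lra|]. intros x Hx.
  rewrite cantor_base_right, cantor_base_left by lra. field.
Qed.

Definition cantor_map : R -> R := per cantor_base.

Lemma cantor_map_shift : (fun x => per cantor_base (x + 0) - 0) = cantor_map.
Proof.
  apply functional_extensionality. intros x. unfold cantor_map.
  rewrite Rplus_0_r. ring.
Qed.

Lemma cantor_map_lift_diff r : lift_diff r cantor_map.
Proof.
  rewrite <- cantor_map_shift. apply per_lift_diff.
  - apply smooth_cantor_base.
  - apply seam_cantor_base.
  - intros x _. apply Derive_cantor_base_pos.
Qed.

Lemma cantor_map_C1lift : C1lift cantor_map.
Proof. apply (lift_diff_C1lift Inf); [exact I|apply cantor_map_lift_diff]. Qed.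

Lemma cantor_map_eq x : 0 <= x < 1 -> cantor_map x = cantor_base x.
Proof.
  intros H. unfold cantor_map. rewrite (per_eq _ 0) by lra. rewrite Rminus_0_r. ring.
Qed.

Lemma cantor_map_near0 x : -27 / 100 < x < 33 / 50 ->
  cantor_map x = x / 3 /\ Derive cantor_map x = / 3.
Proof.
  intros H.
  assert (E : forall y, -27 / 100 < y < 33 / 50 -> cantor_map y = y / 3).
  { intros y Hy. destruct (Rlt_dec y 0) as [L|L].
    - replace y with (y + 1 + IZR (-1)) at 1 by (simpl; ring).
      rewrite C1lift_Z by apply cantor_map_C1lift.
      rewrite cantor_map_eq, cantor_base_right by lra. field.
    - rewrite cantor_map_eq, cantor_base_left by lra. auto. }
  split; auto. rewrite (Derive_ext_loc _ (fun y => y / 3)).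
  - apply is_derive_unique. auto_derive; auto; field.
  - assert (Hd : 0 < Rmin (x - -27 / 100) (33 / 50 - x)) by (apply Rmin_pos; lra).
    exists (mkposreal _ Hd). intros y Hy. apply Rabs_def2 in Hy. simpl in Hy.
    change (minus y x) with (y - x) in Hy. apply E.
    generalize (Rmin_l (x - -27 / 100) (33 / 50 - x)) (Rmin_r (x - -27 / 100) (33 / 50 - x)). lra.
Qed.

(* The union of the gaps of the Cantor set {x : 3^(n+1) x mod 1 lies in [0,1/2] for all n}. *)
Definition gaps (x : R) : Prop :=
  exists (n : nat) (k : Z), IZR k + 1 / 2 < 3 ^ S n * x < IZR k + 1.

Lemma gaps_first (j : Z) x : IZR j / 3 + 1 / 6 < x < IZR j / 3 + 1 / 3 -> gaps x.
Proof. intros H. exists 0%nat, j. simpl. lra. Qed.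

Lemma gaps_shift (j : Z) x : gaps x -> gaps (x + IZR j / 3).
Proof.
  intros (n & k & H). exists n, (k + 3 ^ Z.of_nat n * j)%Z.
  rewrite plus_IZR, mult_IZR, <- pow_IZR.
  replace (3 ^ S n * (x + IZR j / 3)) with (3 ^ S n * x + 3 ^ n * IZR j) by (simpl; field).
  lra.
Qed.

Lemma gaps_shift1 (j : Z) x : gaps x -> gaps (x + IZR j).
Proof.
  intros H. replace (IZR j) with (IZR (3 * j) / 3) by (rewrite mult_IZR; field).
  apply gaps_shift, H.
Qed.

Lemma gaps_third x : gaps x -> gaps (x / 3).
Proof.
  intros (n & k & H). exists (S n), k.
  replace (3 ^ S (S n) * (x / 3)) with (3 ^ S n * x) by (simpl; field). auto.
Qed.

(** Here 3x and 9x lie in [0, 1/2], so the gap containing [x] has level at least 2, and the factor 9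
    lowers its level by two. *)
Lemma gaps_ninefold x : 0 <= x <= 1 / 18 -> gaps x -> gaps (9 * x).
Proof.
  intros Hx (n & k & H).
  assert (Hk : forall t, 0 <= t <= 1 / 2 -> ~ (IZR k + 1 / 2 < t < IZR k + 1)).
  { intros t Ht (H1 & H2). assert (H3 : IZR k < 0) by lra. assert (H4 : -1 < IZR k) by lra.
    apply lt_IZR in H3, H4. lia. }
  destruct n as [|[|n]].
  - exfalso. apply (Hk (3 ^ 1 * x)); auto. simpl; lra.
  - exfalso. apply (Hk (3 ^ 2 * x)); auto. simpl; lra.
  - exists n, k. replace (3 ^ S n * (9 * x)) with (3 ^ S (S (S n)) * x) by (simpl; ring). auto.
Qed.

(** On [0, 13/20] and [2/3, 13/18] the map is a similarity adapted to the Cantor set. Monotonicity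
    alone sends (13/20, 2/3) into the gap (1/6, 1/3) and (13/18, 1) into the gap (5/6, 1), whatever
    the shape of the transitions. *)
Lemma gaps_cantor_map x : gaps x -> gaps (cantor_map x).
Proof.
  intros H. destruct (exists_floor x) as (k & Hk).
  replace x with (x - IZR k + IZR k) by ring. rewrite C1lift_Z by apply cantor_map_C1lift.
  apply gaps_shift1. apply (gaps_shift1 (- k)) in H. rewrite opp_IZR in H.
  change (x + - IZR k) with (x - IZR k) in H. set (y := x - IZR k) in *. clearbody y. clear x.
  assert (M := C1lift_lt _ cantor_map_C1lift).
  assert (E1 : cantor_map (2 / 3) = 1 / 3).
  { rewrite cantor_map_eq, cantor_base_mid by lra. field. }
  assert (E2 : cantor_map (13 / 18) = 5 / 6).
  { rewrite cantor_map_eq, cantor_base_mid by lra. field. }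
  assert (E3 : cantor_map (0 + IZR 1) = 1).
  { rewrite C1lift_Z by apply cantor_map_C1lift. rewrite cantor_map_eq by lra.
    rewrite cantor_base_left by lra. lra. }
  assert (E4 : cantor_map (13 / 20) = 13 / 60).
  { rewrite (proj1 (cantor_map_near0 (13 / 20) ltac:(lra))). field. }
  destruct (Rle_dec y (13 / 20)) as [L1|L1]; [|destruct (Rlt_dec y (2 / 3)) as [L2|L2];
    [|destruct (Rle_dec y (13 / 18)) as [L3|L3]]].
  - rewrite (proj1 (cantor_map_near0 y ltac:(lra))). apply gaps_third, H.
  - apply (gaps_first 0). generalize (M (13 / 20) y ltac:(lra)) (M y (2 / 3) L2). simpl. lra.
  - rewrite cantor_map_eq, cantor_base_mid by lra.
    replace (1 / 3) with (IZR 1 / 3) by (simpl; field). apply gaps_shift.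
    apply gaps_ninefold; [lra|]. apply (gaps_shift (-2)) in H.
    replace (y - 2 / 3) with (y + IZR (-2) / 3) by (simpl; field). auto.
  - apply (gaps_first 2). generalize (M (13 / 18) y ltac:(lra)) (M y (0 + IZR 1) ltac:(lra)). lra.
Qed.

Lemma gaps_arc_map kap del x : bump_ok kap del -> gaps x -> gaps (arc_map (1 / 6) (1 / 6) kap del x).
Proof.
  intros Hok H. destruct (classic (exists k : Z, 1 / 6 < x - IZR k < 1 / 6 + 1 / 6)) as [(k & Hk)|N].
  - assert (L := arc_map_C1lift (1 / 6) (1 / 6) kap del ltac:(lra) Hok).
    replace x with (x - IZR k + IZR k) by ring. rewrite C1lift_Z by auto.
    apply gaps_shift1, (gaps_first 0).
    assert (M := C1lift_lt _ L).
    generalize (M (1 / 6) (x - IZR k) ltac:(lra)) (M (x - IZR k) (1 / 6 + 1 / 6) ltac:(lra)).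
    rewrite arc_map_left, arc_map_right by lra. simpl. lra.
  - rewrite arc_map_out; [auto|lra|]. intros k Hk. apply N. eauto.
Qed.

Lemma gaps_arcs x : arcs (1 / 6) (1 / 3) x -> gaps x.
Proof.
  intros (k & Hk). replace x with (x - IZR k + IZR k) by ring.
  apply gaps_shift1, (gaps_first 0). simpl. lra.
Qed.

Lemma not_gaps_0 : ~ gaps 0.
Proof.
  intros (n & k & H). rewrite Rmult_0_r in H. destruct H as (H1 & H2).
  assert (H3 : IZR k < 0) by lra. assert (H4 : -1 < IZR k) by lra.
  apply lt_IZR in H3, H4. lia.
Qed.

Lemma exists_RT_minimal_forward r k : le_reg 1 r -> (8 <= k)%nat ->
  exists Fs, RT r (S k) Fs /\ minimal Fs /\ exists Fi, inverse_family Fs Fi /\ ~ minimal Fi.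
Proof.
  intros Hr Hk.
  destruct (bump_ok_pos (1 / 2)) as (del & Hd & Hok); [lra|].
  assert (Hneg : forall kap, 1 / 4 <= kap <= 3 / 4 -> bump_ok kap (-1 / 4)).
  { intros kap H. apply bump_ok_neg; lra. }
  set (rot := fun x : R => x + 1 / 3).
  set (e1 := arc_map (1 / 6) (1 / 6) (2 / 5) (-1 / 4)).
  set (e2 := arc_map (1 / 6) (1 / 6) (3 / 5) (-1 / 4)).
  set (e3 := arc_map (1 / 6) (1 / 6) (1 / 2) del).
  set (Fs := rot :: cantor_map :: e1 :: e2 :: e3 :: repeat (fun x => x + 0) (S k - 5)).
  assert (HL : List.Forall (lift_diff r) Fs).
  { unfold Fs, e1, e2, e3.
    constructor; [apply affine_lift_diff|]. constructor; [apply cantor_map_lift_diff|].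
    do 3 (constructor; [apply arc_map_lift_diff; auto; try apply Hneg; lra|]).
    apply Forall_forall. intros f Hf. apply repeat_spec in Hf. subst f.
    apply affine_lift_diff. }
  assert (HI : IFS r (S k) Fs).
  { split; auto. unfold Fs. cbn [length]. rewrite repeat_length. lia. }
  assert (HC := IFS_C1lift r (S k) Fs Hr HI).
  assert (Q : forall f, In f Fs -> C1lift f) by (apply Forall_forall; auto).
  assert (Ir : In rot Fs) by (unfold Fs; cbn [In]; auto).
  assert (Ic : In cantor_map Fs) by (unfold Fs; cbn [In]; auto).
  assert (I1 : In e1 Fs) by (unfold Fs; cbn [In]; auto).
  assert (I2 : In e2 Fs) by (unfold Fs; cbn [In]; auto 6).
  assert (I3 : In e3 Fs) by (unfold Fs; cbn [In]; auto 7).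
  assert (Sr := sg_gen Fs rot Ir). assert (Sc := sg_gen Fs cantor_map Ic).
  assert (GI : forall f, In f Fs -> forall x, gaps x -> gaps (f x)).
  { intros f [<-|[<-|[<-|[<-|[<-|Hf]]]]] x Hx.
    - apply (gaps_shift 1), Hx.
    - apply gaps_cantor_map, Hx.
    - apply gaps_arc_map; auto. apply Hneg; lra.
    - apply gaps_arc_map; auto. apply Hneg; lra.
    - apply gaps_arc_map; auto.
    - apply repeat_spec in Hf. subst f. rewrite Rplus_0_r; auto. }
  set (j0 := 1 / 6 + 1 / 6 * (3 / 10)). set (j1 := 1 / 6 + 1 / 6 * (7 / 10)).
  set (i0 := 1 / 6 + 1 / 6 * (9 / 20)). set (i1 := 1 / 6 + 1 / 6 * (11 / 20)).
  assert (HB : blender (1 / 6 / 80) (7 / 8) j0 j1 i0 i1 Fs) by (apply arc_blender; auto; lra).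
  assert (Fg : forall x, fgood Fs j0 j1 x).
  { assert (A1 : forall x, 1 / 6 < x < 1 / 3 -> fgood Fs j0 j1 x).
    { intros x Hx. apply arc_forward; auto; lra. }
    assert (R1 : forall x, fgood Fs j0 j1 (x - 2 / 3) -> fgood Fs j0 j1 x).
    { intros x H. apply (fgood_pull Fs j0 j1 rot x Sr). unfold rot.
      replace (x + 1 / 3) with (x - 2 / 3 + IZR 1) by (simpl; field). apply fgood_Z; auto. }
    assert (A2 : forall x, 5 / 6 < x < 1 -> fgood Fs j0 j1 x).
    { intros x Hx. apply R1, A1. lra. }
    (* The route runs through [1/3, 1/2], [1/9, 1/6] and [7/9, 5/6] into the gap (5/6, 1). Without
       the initial rotation, contracting and rotating twice would end in [2/3, 13/18], where the map
       takes the Cantor set to itself. *)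
    assert (A3 : forall x, 0 <= x <= 1 / 6 -> fgood Fs j0 j1 x).
    { intros x Hx. apply (fgood_pull _ _ _ rot x Sr), (fgood_pull _ _ _ cantor_map _ Sc).
      unfold rot at 1. rewrite (proj1 (cantor_map_near0 (x + 1 / 3) ltac:(lra))).
      apply (fgood_pull _ _ _ rot _ Sr), (fgood_pull _ _ _ rot _ Sr), (fgood_pull _ _ _ cantor_map _ Sc).
      unfold rot. apply A2.
      rewrite cantor_map_eq, cantor_base_right by lra. lra. }
    assert (A4 : forall x, 0 <= x < 1 / 3 -> fgood Fs j0 j1 x).
    { intros x Hx. destruct (Rle_dec x (1 / 6)); [apply A3|apply A1]; lra. }
    intros x. destruct (exists_floor x) as (m & Hm).
    replace x with (x - IZR m + IZR m) by ring. apply fgood_Z; auto.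
    set (y := x - IZR m) in *. clearbody y.
    destruct (Rlt_dec y (1 / 3)); [apply A4; lra|].
    destruct (Rlt_dec y (2 / 3)); [|apply R1, A4; lra].
    apply (fgood_pull _ _ _ rot y Sr), R1. unfold rot. apply A4; lra. }
  assert (Bg : forall y, bgood Fs i0 i1 y \/ bexp Fs i0 i1 (3 / 2) y).
  { assert (A1 : forall y, 1 / 6 < y < 1 / 3 -> bgood Fs i0 i1 y).
    { intros y Hy. apply (arc_backward _ _ del); auto; lra. }
    assert (A2 : forall y, 0 <= y < 1 / 3 -> bgood Fs i0 i1 y \/ bexp Fs i0 i1 (3 / 2) y).
    { intros y Hy. destruct (Rle_dec y (1 / 6)) as [L|L]; [right|left; apply A1; lra].
      assert (E := cantor_map_near0).
      (* The contraction by 1/3 maps this interval onto [-1/100, 53/300], a neighbourhood of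
         [0, 1/6] with both endpoints in gaps that are already reached. *)
      exists cantor_map, (-3 / 100), (53 / 100), 0%Z. split; auto. split; [lra|].
      rewrite (proj1 (E (-3 / 100) ltac:(lra))), (proj1 (E (53 / 100) ltac:(lra))).
      split; [lra|]. split; [|split].
      - replace (-3 / 100 / 3) with (rot (rot (97 / 300)) + IZR (-1)) by (unfold rot; simpl; field).
        apply bgood_Z, bgood_push, bgood_push; auto. apply A1; lra.
      - apply A1; lra.
      - intros z Hz. rewrite (proj2 (E z ltac:(lra))). lra. }
    (* A rotation applied last is an isometry and keeps the contraction rate of the word. *)
    assert (R1 : forall y, bgood Fs i0 i1 y \/ bexp Fs i0 i1 (3 / 2) y ->
      bgood Fs i0 i1 (rot y) \/ bexp Fs i0 i1 (3 / 2) (rot y)).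
    { intros y [H|(h & p & q & m & Hh & Hpq & Hy & Gp & Gq & D)].
      - left. apply bgood_push; auto.
      - right. assert (Lh : C1lift h) by (eapply in_sg_C1lift; eauto).
        exists (fun x => rot (h x)), p, q, m. split; [apply sg_comp; auto|]. split; auto.
        split; [unfold rot; lra|]. split; [apply bgood_push; auto|].
        split; [apply bgood_push; auto|].
        intros z Hz. rewrite Derive_comp_C1lift by auto.
        replace (Derive rot (h z)) with 1; [rewrite Rmult_1_r; auto|].
        symmetry. apply is_derive_unique. unfold rot. auto_derive; auto. }
    intros y. destruct (exists_floor y) as (m & Hm).
    assert (Z1 : bgood Fs i0 i1 (y - IZR m) \/ bexp Fs i0 i1 (3 / 2) (y - IZR m)).
    { set (t := y - IZR m) in *. clearbody t.
      destruct (Rlt_dec t (1 / 3)); [apply A2; lra|].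
      destruct (Rlt_dec t (2 / 3)).
      - replace t with (rot (t - 1 / 3)) by (unfold rot; ring). apply R1, A2; lra.
      - replace t with (rot (rot (t - 2 / 3))) by (unfold rot; field). apply R1, R1, A2; lra. }
    replace y with (y - IZR m + IZR m) by ring.
    destruct Z1; [left; apply bgood_Z|right; apply bexp_Z]; auto. }
  exists Fs. split; [|split].
  - apply (RT_of_blender r (S k) (1 / 6 / 80) (7 / 8) j0 j1 i0 i1 (3 / 2)); auto; lra.
  - apply (minimal_of_blender (7 / 8) j0 j1 i0 i1 (3 / 2)); auto; [lra|].
    eapply blender_close; [exact HB|]. apply fam_close_refl; lra.
  - destruct (inverse_family_exists Fs HC) as (Fi & HFi). exists Fi; split; auto.
    apply (not_minimal_of_invariant Fi (fun x => ~ gaps x) (arcs (1 / 6) (1 / 3)) 0).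
    (* If [g x] lay in a gap, so would x = f (g x), since [f] maps gaps into gaps. *)
    + intros g Hg x Hx Hgx. destruct (inverse_family_In _ _ _ HFi Hg) as (f & Hf & E).
      apply Hx. rewrite <- (proj1 (E x)). apply GI; auto.
    + apply not_gaps_0.
    + apply arcs_open.
    + exists (1 / 4), 0%Z. lra.
    + intros x Hx N. apply N, gaps_arcs, Hx.
Qed.

Theorem theoremF : forall (r : reg) (k : nat),
  le_reg 1 r -> (8 <= k)%nat ->
  (exists Fs, RT r (S k) Fs /\ minimal Fs /\
     exists Fi, inverse_family Fs Fi /\ ~ minimal Fi) /\
  (exists Gs, RT r k Gs /\ ~ minimal Gs /\
     exists Gi, inverse_family Gs Gi /\ ~ minimal Gi).
Proof.
  intros r k Hr Hk. split.
  - apply exists_RT_minimal_forward; auto.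
  - apply exists_RT_not_minimal; auto.
Qed.
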